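(* Suppose $\zeta$ satisfies properties P3, P4, P5$'$, P6 and P8 (stated in the context). Suppose $\mu$ is absolutely continuous, and its density $f_\mu$ can be chosen in such a way that $f_\mu^{-1}((0,\infty))$ is Riemann measurable. Suppose $r_n\to0$ and $n r_n^d\to\infty$ as $n\to\infty$. Then, almost surely, $$\lim_{n\to\infty} r_n^d\,\zeta_{r_n}(\mathcal X_n)=\overline\zeta\;\mathrm{Leb}\big(f_\mu^{-1}((0,\infty))\big).$$
   Context: Fix $d\in\mathbb N$. $\mu$ is a probability measure on $\mathbb R^d$, $X_1,X_2,\dots$ are i.i.d. with distribution $\mu$, $\mathcal X_n:=\{X_1,\dots,X_n\}$, and $(r_n)_{n\ge1}$ is a sequence of positive reals. $\mathrm{Leb}$ is Lebesgue measure. A set $A\subset\mathbb R^d$ is Riemann measurable if $\mathbf 1_A$ is Riemann integrable, i.e. $A$ is bounded and $\partial A$ has Lebesgue measure zero. $B_r(x)$ is the closed Euclidean ball, $o$ the origin, $Q_s:=[-s/2,s/2)^d$. For finite $\mathcal X\subset\mathbb R^d$ and $r>0$, $G(\mathcal X,r)$ is the graph on vertex set $\mathcal X$ with an edge between distinct points at Euclidean distance at most $r$. $\zeta$ is a non-negative real-valued function on the finite subsets of $\mathbb R^d$ with $\zeta(\emptyset)=0$, and $\zeta_r(\mathcal X):=\zeta(r^{-1}\mathcal X)$. Properties: P3: there is $c_1\in[0,\infty)$ with $\zeta(\mathcal Y\cup\mathcal Z)\le\zeta(\mathcal Y)+\zeta(\mathcal Z)+c_1$ for all disjoint finite $\mathcal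 Y,\mathcal Z\subset\mathbb R^d$. P4: there is $c_2\in[0,\infty)$ such that for every ordered pair $(\mathcal Y,\mathcal Z)$ of disjoint finite subsets of $\mathbb R^d$, $\zeta(\mathcal Y\cup\mathcal Z)\ge\zeta(\mathcal Y)+\zeta(\mathcal Z)-c_2|\partial_{\mathcal Z}(\mathcal Y)|$, where $\partial_{\mathcal Z}(\mathcal Y)$ is the set of points of $\mathcal Y$ at Euclidean distance at most $1$ from $\mathcal Z$. P5$'$: $\sup\{|\zeta(\mathcal X)|:\mathcal X\subset B_{1/2}(o),|\mathcal X|<\infty\}<\infty$. P6: $\zeta(\mathcal X)\le\zeta(\mathcal X\cup\mathcal Y)$ for all finite $\mathcal X,\mathcal Y\subset\mathbb R^d$. P8: $\zeta(\mathcal X)=\zeta(\mathcal Y)$ whenever $G(\mathcal X,1)$ is isomorphic to $G(\mathcal Y,1)$. For $A\subset\mathbb R^d$, $\zeta^*(A):=\sup\{\zeta(\mathcal X):\mathcal X\subset A,|\mathcal X|<\infty\}$, and $\overline\zeta:=\lim_{s\to\infty}s^{-d}\zeta^*(Q_s)$ (under these properties the limit exists in $[0,\infty)$). *)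

(* Defs.v *)
From HB Require Import structures.
From mathcomp Require Import all_boot all_order all_algebra finmap.
From mathcomp Require Import all_classical all_reals all_analysis.

Set Implicit Arguments.
Unset Strict Implicit.
Unset Printing Implicit Defensive.

Import Order.TTheory GRing.Theory Num.Theory.
Import numFieldNormedType.Exports.

Local Open Scope classical_set_scope.
Local Open Scope ring_scope.

(* R^n is 'rV[R]_n. Its sigma-algebra is the Borel one, generated by the open
   sets of the library topology on matrices. *)
Section borel_rV.
Variables (R : realType) (n : nat).
Let G : set (set 'rV[R]_n) := open.
HB.instance Definition _ := @isMeasurable.Build (sigma_display G) 'rV[R]_n
  <<s G >> (@sigma_algebra0 _ setT G) (@sigma_algebraC _ G)
  (@sigma_algebra_bigcup _ setT G).
End borel_rV.

Section borel_rV_theory.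
Context {R : realType}.

Lemma measurable_coord n (i : 'I_n) :
  measurable_fun [set: 'rV[R]_n] (fun v : 'rV[R]_n => v ord0 i).
Proof.
apply: (measurability _ (measurable_realfun.RGenOpens.measurableE R)).
move=> _ [_ [x [y ->]] <-]; rewrite setTI; apply: sub_sigma_algebra.
by apply: open_comp => [v _|]; [exact: coord_continuous|exact: interval_open].
Qed.

Lemma measurable_fun_rV d (T : measurableType d) n (f : T -> 'rV[R]_n) :
  (forall i, measurable_fun setT (fun t => f t ord0 i)) ->
  measurable_fun setT f.
Proof.
move=> mf; apply: (@measurability _ _ _ _ _ _ (@open 'rV[R]_n)) => //.
move=> _ [U oU <-]; rewrite setTI.
pose box (ab : 'rV[rat]_n * 'rV[rat]_n) := [set v : 'rV[R]_n | forall i,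
  v ord0 i \in `]ratr (ab.1 ord0 i), ratr (ab.2 ord0 i)[ ].
have -> : U = \bigcup_(ab in [set ab | box ab `<=` U]) box ab.
  rewrite eqEsubset; split=> [v Uv|v [ab sU /sU//]].
  have [P nP sPU] : nbhs v U by apply: open_nbhs_nbhs.
  have /choice[q hq] (i : 'I_n) : exists q : rat * rat,
      [/\ v ord0 i \in `]ratr q.1, ratr q.2[ &
      [set` `]ratr q.1, ratr q.2[] `<=` P ord0 i].
    have /nbhs_ballP[e /= e0 be] := nP ord0 i.
    have /rat_in_itvoo[a] : v ord0 i - e < v ord0 i by rewrite ltrBlDr ltrDl.
    have /rat_in_itvoo[b] : v ord0 i < v ord0 i + e by rewrite ltrDl.
    rewrite !in_itv/= => /andP[vb be'] /andP[ae av].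
    exists (a, b); split; first by rewrite in_itv/= av.
    move=> x; rewrite /= in_itv/= => /andP[ax xb]; apply: be.
    rewrite /ball/= ltr_distlC; apply/andP; split.
      exact: lt_trans ae ax.
    exact: lt_trans xb be'.
  exists (\row_i (q i).1, \row_i (q i).2).
    move=> w hw; apply: sPU => i j; rewrite ord1.
    have [_] := hq j; apply; have := hw j.
    by rewrite /= !mxE.
  by move=> i; rewrite /= !mxE; have [] := hq i.
rewrite preimage_bigcup bigcup_mkcond.
apply: countable_bigcupT_measurable => // ab; case: ifPn => // _.
rewrite (_ : _ @^-1` _ = \bigcap_(i in [set: 'I_n]) ((fun t => f t ord0 i) @^-1`
    `]ratr (ab.1 ord0 i), ratr (ab.2 ord0 i)[ )).
  apply: fin_bigcap_measurable => // i _; rewrite -[X in measurable X]setTI.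
  by apply: mf => //; exact: measurable_itv.
by apply/seteqP; split=> t /= ht i; [move=> _; exact: ht|exact: ht].
Qed.

End borel_rV_theory.

Definition rV_cons (R : realType) n (xv : measurableTypeR R * 'rV[R]_n) :
    'rV[R]_n.+1 :=
  row_mx (xv.1 : R)%:M xv.2.

Definition rV_uncons (R : realType) n (v : 'rV[R]_n.+1) :
    measurableTypeR R * 'rV[R]_n :=
  (v ord0 ord0, \row_i v ord0 (lift ord0 i)).

Lemma rV_cons0 (R : realType) n (xv : measurableTypeR R * 'rV[R]_n) :
  rV_cons xv ord0 ord0 = xv.1.
Proof.
transitivity (((xv.1 : R)%:M : 'M[R]_1) ord0 ord0); last by rewrite mxE eqxx.
rewrite -(row_mxEl (xv.1 : R)%:M xv.2).
by apply: (congr1 (rV_cons xv ord0)); exact/val_inj.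
Qed.

Lemma rV_consS (R : realType) n (xv : measurableTypeR R * 'rV[R]_n) i :
  rV_cons xv ord0 (lift ord0 i) = xv.2 ord0 i.
Proof.
rewrite -(row_mxEr (xv.1 : R)%:M xv.2).
by apply: (congr1 (rV_cons xv ord0)); exact/val_inj.
Qed.

Lemma rV_consK (R : realType) n : cancel (@rV_cons R n) (@rV_uncons R n).
Proof.
move=> [x v]; rewrite /rV_uncons rV_cons0; congr pair.
by apply/rowP => i; rewrite mxE rV_consS.
Qed.

Lemma measurable_rV_cons (R : realType) n :
  measurable_fun setT (@rV_cons R n).
Proof.
apply: measurable_fun_rV => i; have [j ->|->] := unliftP ord0 i.
  under eq_fun do rewrite rV_consS.
  by apply: (measurableT_comp (measurable_coord j)); exact: measurable_snd.
by under eq_fun do rewrite rV_cons0; exact: measurable_fst.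
Qed.

Lemma measurable_rV_uncons (R : realType) n :
  measurable_fun setT (@rV_uncons R n).
Proof.
apply: measurable_fun_pair; first exact: measurable_coord.
apply: measurable_fun_rV => i; under eq_fun do rewrite mxE.
exact: measurable_coord.
Qed.

Section lebesgue_rVS.
Context {R : realType} {n : nat}.
Variable mu : {sigma_finite_measure set 'rV[R]_n -> \bar R}.

Definition lebesgue_rVS : set 'rV[R]_n.+1 -> \bar R :=
  pushforward (@lebesgue_measure R \x mu)%E (@rV_cons R n).

Let lebesgue_rVS0 : lebesgue_rVS set0 = 0%E.
Proof. by rewrite /lebesgue_rVS /pushforward preimage_set0 measure0. Qed.

Let lebesgue_rVS_ge0 A : (0 <= lebesgue_rVS A)%E.
Proof. exact: (measure_ge0 (lebesgue_measure \x mu)%E). Qed.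

Let lebesgue_rVS_sigma_additive : semi_sigma_additive lebesgue_rVS.
Proof.
apply: (@measure_semi_sigma_additive _ _ _ (pushforward _ _)).
exact: measurable_rV_cons.
Qed.

HB.instance Definition _ := isMeasure.Build _ _ _ lebesgue_rVS
  lebesgue_rVS0 lebesgue_rVS_ge0 lebesgue_rVS_sigma_additive.

Let lebesgue_rVS_sigma_finite : sigma_finite setT lebesgue_rVS.
Proof.
have /sigma_finiteP[F [FT ndF Foo]] := sigma_finiteT (@lebesgue_measure R).
have /sigma_finiteP[G [GT ndG Goo]] := sigma_finiteT mu.
exists (fun k => @rV_uncons R n @^-1` (F k `*` G k)).
  rewrite -preimage_bigcup; apply/esym; rewrite -subTset => v _ /=.
  have : [set: measurableTypeR R] (rV_uncons v).1 by [].
  rewrite FT => -[k _ Fk].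
  have : [set: 'rV[R]_n] (rV_uncons v).2 by [].
  rewrite GT => -[l _ Gl].
  exists (maxn k l) => //; split.
    by move: Fk; exact/subsetPset/ndF/leq_maxl.
  by move: Gl; exact/subsetPset/ndG/leq_maxr.
move=> k; have [mF Fk] := Foo k; have [mG Gk] := Goo k; split.
  rewrite -[X in measurable X]setTI; apply: measurable_rV_uncons => //.
  exact: measurableX.
rewrite /lebesgue_rVS /pushforward -comp_preimage.
rewrite (_ : _ \o _ = id); last by apply/funext => xv; exact: rV_consK.
by rewrite product_measure1E// lte_mul_pinfty// ge0_fin_numE.
Qed.

HB.instance Definition _ := Measure_isSigmaFinite.Build _ _ _ lebesgue_rVS
  lebesgue_rVS_sigma_finite.

End lebesgue_rVS.

(* Lebesgue measure on R^n as an iterated product of the one-dimensional one;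
   lebesgue_rV_box gives its values on boxes. *)
Fixpoint lebesgue_rV (R : realType) n :
    {sigma_finite_measure set 'rV[R]_n -> \bar R} :=
  if n is n'.+1 then @lebesgue_rVS R n' (lebesgue_rV R n')
  else @dirac _ 'rV[R]_0 0 R.

Lemma lebesgue_rV_box (R : realType) n (A : 'I_n -> set (measurableTypeR R)) :
  (forall i, measurable (A i)) ->
  lebesgue_rV R n [set v | forall i, A i (v ord0 i)] =
    (\prod_(i < n) lebesgue_measure (A i))%E.
Proof.
elim: n A => [|n IHn] A mA.
  by rewrite big_ord0 /= diracE mem_set// => -[].
pose B := [set v : 'rV[R]_n | forall i, A (lift ord0 i) (v ord0 i)].
have mB : measurable B.
  have -> : B = \bigcap_(i in [set: 'I_n])
      ((fun v : 'rV[R]_n => v ord0 i) @^-1` A (lift ord0 i)).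
    by apply/seteqP; split=> v /= hv i; [move=> _; exact: hv|exact: hv].
  apply: fin_bigcap_measurable => // i _; rewrite -[X in measurable X]setTI.
  by apply: measurable_coord => //; exact: mA.
rewrite big_ord_recl -(IHn (fun i => A (lift ord0 i))) => [|i]; last exact: mA.
rewrite -/B -product_measure1E//.
rewrite /= /lebesgue_rVS /pushforward; congr (product_measure1 _ _ _).
apply/seteqP; split=> -[x v] /=.
  move=> Axv; split=> [|i]; first by have := Axv ord0; rewrite rV_cons0.
  by have := Axv (lift ord0 i); rewrite rV_consS.
move=> [Ax Av] i; have [j ->|->] := unliftP ord0 i.
  by rewrite rV_consS; exact: Av.
by rewrite rV_cons0.
Qed.

Section random_points.
Context {R : realType} {n : nat}.

Definition edist (x y : 'rV[R]_n) : R :=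
  Num.sqrt (\sum_(i < n) (x ord0 i - y ord0 i) ^+ 2).

Definition closed_eball (x : 'rV[R]_n) (r : R) : set 'rV[R]_n :=
  [set y | edist x y <= r].

Definition cube (s : R) : set 'rV[R]_n :=
  [set x | forall i, x ord0 i \in `[- (s / 2), s / 2[].

Definition boundary (A : set 'rV[R]_n) : set 'rV[R]_n := closure A `\` A°.

Definition riemann_measurable (A : set 'rV[R]_n) : Prop :=
  bounded_set A /\ lebesgue_rV R n (boundary A) = 0%E.

Definition is_density (mu : set 'rV[R]_n -> \bar R) (f : 'rV[R]_n -> R) : Prop :=
  [/\ measurable_fun setT f, (forall x, 0 <= f x) &
      forall A, measurable A ->
        mu A = (\int[lebesgue_rV R n]_(x in A) (f x)%:E)%E].

Definition identically_distributed d (T : measurableType d)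
    (P : probability T R) (X : nat -> {RV P >-> 'rV[R]_n})
    (mu : probability 'rV[R]_n R) : Prop :=
  forall i A, measurable A -> distribution P (X i) A = mu A.

Definition mutually_independent d (T : measurableType d)
    (P : probability T R) (X : nat -> {RV P >-> 'rV[R]_n}) : Prop :=
  forall (J : {fset nat}) (A : nat -> set 'rV[R]_n),
    (forall j, measurable (A j)) ->
    P (\bigcap_(j in [set` J]) (X j @^-1` A j)) =
      (\prod_(j <- J) P (X j @^-1` A j))%E.

(* The sequence is indexed from 0, so this is the set of its first k points. *)
Definition sample (X : nat -> 'rV[R]_n) (k : nat) : {fset 'rV[R]_n} :=
  [fset X i | i in iota 0 k]%fset.

(* The vertices of the geometric graph on S are the elements of the finite
   type attached to S, and this is its adjacency relation. *)
Definition geom_adj (S : {fset 'rV[R]_n}) (r : R) : rel S :=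
  fun x y => (x != y) && (edist (val x) (val y) <= r).

Definition geom_graph_isom (S T : {fset 'rV[R]_n}) (r : R) : Prop :=
  exists f : S -> T,
    bijective f /\ forall x y, geom_adj r (f x) (f y) = geom_adj r x y.

Definition near_points (Z Y : {fset 'rV[R]_n}) : {fset 'rV[R]_n} :=
  [fset y in Y | has (fun z => edist y z <= 1) Z]%fset.

Section functional.
Variable zeta : {fset 'rV[R]_n} -> R.

Definition almost_subadditive : Prop :=
  exists2 c : R, 0 <= c & forall Y Z : {fset 'rV[R]_n}, [disjoint Y & Z]%fset ->
    zeta (Y `|` Z)%fset <= zeta Y + zeta Z + c.

Definition superadditive_up_to_boundary : Prop :=
  exists2 c : R, 0 <= c & forall Y Z : {fset 'rV[R]_n}, [disjoint Y & Z]%fset ->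
    zeta Y + zeta Z - c * #|` near_points Z Y|%:R <= zeta (Y `|` Z)%fset.

Definition bounded_on_half_ball : Prop :=
  (ereal_sup [set `|zeta S|%:E | S in
    [set S : {fset 'rV[R]_n} | [set` S] `<=` closed_eball 0 (1 / 2)]] < +oo)%E.

Definition increasing_functional : Prop :=
  forall S T : {fset 'rV[R]_n}, zeta S <= zeta (S `|` T)%fset.

Definition graph_invariant : Prop :=
  forall S T : {fset 'rV[R]_n}, geom_graph_isom S T 1 -> zeta S = zeta T.

Definition rescaled (r : R) (S : {fset 'rV[R]_n}) : R :=
  zeta [fset r^-1 *: x | x in S]%fset.

Definition zeta_star (A : set 'rV[R]_n) : \bar R :=
  ereal_sup [set (zeta S)%:E | S in [set S : {fset 'rV[R]_n} | [set` S] `<=` A]].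

(* zeta_star may a priori be infinite, so the limit is taken in \bar R. *)
Definition zeta_bar : \bar R :=
  lim (((s ^- n)%:E * zeta_star (cube s))%E @[s --> +oo%R]).

End functional.
End random_points.

(* Main.v *)
(**
Write A for the support {f > 0}, L for the limit of s^-d zeta_star(Q_s), and
tile R^d by cells of side comparable to r_n.

Upper bound, deterministic once the sample lies in A: by almost subadditivity
the rescaled functional is at most the number of cells of side s r_n meeting A
times zeta_star(Q_s) + c; since A is Riemann measurable that number is
asymptotic to Leb(A) / (s r_n)^d. Then let s tend to infinity.

Lower bound: choose a nearly optimal finite S in Q_s, contracted slightly so
that every small perturbation of S has the same graph. In every cell of side
(s + 2) r_n inside A put a scaled copy of S with a small ball around each of
its points. If the sample hits all the balls of a cell, it contains there a
configuration with the graph of S; configurations in different cells are at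
scaled distance more than 1, so they contribute additively, without boundary
terms, and the other sample points only increase zeta.

It remains to see that few cells are spoiled, although no assumption such as
n r_n^d >> log n forbids empty balls. There are O(r_n^-d) = o(n) balls, hence
exp(o(n)) unions of balls. A given union in A of Lebesgue measure at least eps
has mu-measure at least some delta(eps) > 0, so it is missed by the sample with
probability at most exp(- delta n). A union bound and Borel-Cantelli show that
almost surely the missed balls eventually have total measure below eps.
*)
Require Import Defs.
From HB Require Import structures.
From mathcomp Require Import all_boot all_order all_algebra finmap.
From mathcomp Require Import all_classical all_reals all_analysis.
From mathcomp Require Import ring lra zify.

Set Implicit Arguments.
Unset Strict Implicit.
Unset Printing Implicit Defensive.

Import Order.TTheory GRing.Theory Num.Theory.
Import numFieldNormedType.Exports.

Local Open Scope classical_set_scope.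
Local Open Scope ring_scope.

(** * Grid cells of side [rho] and their integer indices *)

Section cells.
Context {R : realType} {d : nat}.
Implicit Types (x y : 'rV[R]_d) (A : set 'rV[R]_d).

(** Balls on row vectors are those of the sup norm, that is, open cubes; Euclidean distance enters
    only through [edist]. *)
Lemma ball_rVP x y e : 0 < e ->
  ball x e y <-> forall i, `|x ord0 i - y ord0 i| < e.
Proof.
move=> e0; split=> [[_ xy] i|xy]; first exact: xy.
by split=> // i j; rewrite ord1; exact: xy.
Qed.

Lemma open_measurable_rV A : open A -> measurable A.
Proof. exact: sub_sigma_algebra. Qed.

Lemma closed_measurable_rV A : closed A -> measurable A.
Proof.
move=> cA; rewrite -[A]setCK; apply: measurableC.
by apply: open_measurable_rV; rewrite openC.
Qed.

Lemma measurable_itv_box (I : 'I_d -> interval R) :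
  measurable [set v : 'rV[R]_d | forall i, v ord0 i \in I i].
Proof.
rewrite (_ : [set _ | _] = \bigcap_(i in [set: 'I_d])
    ((fun v : 'rV[R]_d => v ord0 i) @^-1` [set` I i])).
  apply: fin_bigcap_measurable => // i _; rewrite -[X in measurable X]setTI.
  by apply: measurable_coord => //; exact: measurable_itv.
by apply/seteqP; split=> t /= ht i; [move=> _; exact: ht|exact: ht].
Qed.

Lemma lebesgue_rV_itv_box (I : 'I_d -> interval R) h :
  0 <= h -> (forall i, lebesgue_measure ([set` I i] : set R) = h%:E) ->
  lebesgue_rV R d [set v | forall i, v ord0 i \in I i] = (h ^+ d)%:E.
Proof.
move=> h0 Ih.
rewrite (lebesgue_rV_box (A := fun i => [set` I i])) => [|i]; last exact: measurable_itv.
rewrite (eq_bigr (fun=> h%:E)) => [|i _]; last exact: Ih.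
by rewrite prodEFin prodr_const card_ord.
Qed.

Lemma lebesgue_rV_ball x e : 0 < e ->
  lebesgue_rV R d (ball x e) = ((2 * e) ^+ d)%:E.
Proof.
move=> e0.
rewrite -(lebesgue_rV_itv_box (I := fun i => `]x ord0 i - e, x ord0 i + e[)).
- congr (lebesgue_rV R d _); apply/seteqP; split=> y /=.
    by move=> /(ball_rVP _ _ e0) xy i; rewrite in_itv/= -ltr_distlC.
  move=> xy; apply/ball_rVP => // i.
  by have := xy i; rewrite in_itv/= -ltr_distlC.
- by lra.
- move=> i; rewrite lebesgue_measure_itv/= lte_fin.
  by rewrite ifT; [rewrite -EFinB; congr EFin; ring|lra].
Qed.

Lemma bounded_sub_ball A : bounded_set A -> exists2 M, 0 < M & A `<=` ball 0 M.
Proof.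
move=> [M [_ hM]]; exists (`|M| + 2); first by rewrite ltr_wpDl.
move=> x Ax; rewrite mx_norm_ball /ball_/= sub0r normrN.
apply: (@le_lt_trans _ _ (`|M| + 1)); last by rewrite ltrD2l ltr1n.
by apply: (hM (`|M| + 1)) => //; rewrite (le_lt_trans (ler_norm M))// ltrDl.
Qed.

Definition cell (rho : R) (k : 'rV[int]_d) : set 'rV[R]_d :=
  [set x | forall i,
    x ord0 i \in `[rho * (k ord0 i)%:~R, rho * (k ord0 i + 1)%:~R[].

Definition cell_index (rho : R) x : 'rV[int]_d :=
  \row_i Num.floor (x ord0 i / rho).

Variable rho : R.
Hypothesis rho_gt0 : 0 < rho.

Lemma cellP k x : cell rho k x <-> cell_index rho x = k.
Proof.
have H i m : (x ord0 i \in `[rho * m%:~R, rho * (m + 1)%:~R[) =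
    (Num.floor (x ord0 i / rho) == m).
  by rewrite in_itv/= floor_eq ler_pdivlMr// ltr_pdivrMr// !(mulrC rho).
split=> [xk|<-].
  by apply/rowP => i; rewrite mxE; apply/eqP; rewrite -H; exact: xk.
by move=> i; rewrite mxE H.
Qed.

Lemma cell_cell_index x : cell rho (cell_index rho x) x.
Proof. exact/cellP. Qed.

Lemma cell_ball k x y : cell rho k x -> cell rho k y -> ball x rho y.
Proof.
move=> xk yk; apply/ball_rVP => // i; have := xk i; have := yk i.
rewrite !in_itv/= intrD mulrDr mulr1 => /andP[y1 y2] /andP[x1 x2].
by rewrite ltr_norml; lra.
Qed.

Lemma measurable_cell k : measurable (cell rho k).
Proof.
exact: measurable_itv_box.
Qed.

Lemma lebesgue_cell k : lebesgue_rV R d (cell rho k) = (rho ^+ d)%:E.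
Proof.
apply: (lebesgue_rV_itv_box (I := fun i =>
  `[rho * (k ord0 i)%:~R, rho * (k ord0 i + 1)%:~R[)) => [|i]; first exact: ltW.
rewrite lebesgue_measure_itv/= lte_fin intrD mulrDr mulr1.
by rewrite ltrDl rho_gt0 -EFinB addrC addKr.
Qed.

Lemma trivIset_cell (D : set 'rV[int]_d) : trivIset D (cell rho).
Proof.
by move=> k l _ _ [x [/cellP <- /cellP <-]].
Qed.

Lemma finite_cell_index A : bounded_set A -> finite_set (cell_index rho @` A).
Proof.
move=> /bounded_sub_ball[M M0 AM].
set N := (Num.truncn (M / rho)).+1.
(* The indices have coordinates in [-N, N]; shifting by [N] encodes them by 2N + 1 ordinals. *)
pose g (m : 'rV['I_(N.*2.+1)]_d) : 'rV[int]_d :=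
  \row_i ((m ord0 i : nat)%:Z - N%:Z).
apply: (@sub_finite_set _ _ (g @` setT)); last first.
  exact/finite_image/finite_finset.
move=> _ [x Ax <-].
have xN i : (- N%:Z <= cell_index rho x ord0 i <= N%:Z)%R.
  have xM : `|x ord0 i| <= M.
    have /ball_rVP - /(_ M0 i) := AM _ Ax.
    by rewrite mxE sub0r normrN => /ltW.
  have xN : `|x ord0 i / rho| <= N%:R.
    rewrite normrM normfV (gtr0_norm rho_gt0).
    apply: (@le_trans _ _ (M / rho)).
      by rewrite ler_pM2r// invr_gt0.
    by apply: ltW; apply: truncnS_gt.
  rewrite mxE; move: xN; rewrite ler_norml => /andP[x1 x2].
  apply/andP; split.
    by rewrite floor_ge_int// rmorphN.
  rewrite -(ler_int R); apply: le_trans x2.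
  by have /andP[] := floor_itv (x ord0 i / rho).
exists (\row_i inord (absz (cell_index rho x ord0 i + N%:Z))) => //.
apply/rowP => i; rewrite /g !mxE.
have := xN i; rewrite mxE; move: (Num.floor _) => z /andP[z1 z2].
rewrite inordK; first by rewrite gez0_abs; lia.
by lia.
Qed.

End cells.

(** * Counting the cells that meet a set or lie inside it *)

Section counting.
Context {R : realType} {d : nat}.
Implicit Types (x y : 'rV[R]_d) (A : set 'rV[R]_d).
Local Notation leb := (lebesgue_rV R d).

Lemma lebesgue_bigcup_cell rho (D : set 'rV[int]_d) : 0 < rho -> finite_set D ->
  leb (\bigcup_(k in D) cell rho k) = (#|` fset_set D|%:R * rho ^+ d)%:E.
Proof.
move=> rho0 finD; rewrite measure_fin_bigcup//=.
- rewrite (eq_fsbigr (fun=> (rho ^+ d)%:E)) => [|k _]; last exact: lebesgue_cell.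
  rewrite fsbig_finite//= sumEFin big_const_seq count_predT iter_addr_0.
  by rewrite mulr_natl.
- exact: trivIset_cell.
- by move=> k _; exact: measurable_cell.
Qed.

Definition thickening A e := \bigcup_(a in A) ball a e.

Lemma measurable_thickening A e : 0 < e -> measurable (thickening A e).
Proof.
move=> e0; apply: open_measurable_rV; apply: bigcup_open => a _.
exact: ball_open.
Qed.

Lemma closure_thickening A : closure A = \bigcap_n thickening A n.+1%:R^-1.
Proof.
apply/seteqP; split=> [x Ax n _|x Ax].
  have n0 : 0 < n.+1%:R^-1 :> R by rewrite invr_gt0.
  have [y [Ay xy]] := Ax _ (nbhsx_ballx x _ n0).
  by exists y => //; exact: ball_sym.
move=> B /nbhs_ballP[e /= e0 eB].
have [n _ /(_ n (leqnn n)) ne] := near_infty_natSinv_lt (PosNum e0).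
have [a Aa ax] := Ax n I.
exists a; split => //; apply: eB; apply: (le_ball (ltW ne)).
exact: ball_sym.
Qed.

Lemma lebesgue_bounded A : bounded_set A -> measurable A -> (leb A < +oo)%E.
Proof.
move=> /bounded_sub_ball[M M0 AM] mA.
apply: (@le_lt_trans _ _ (leb (ball 0 M))).
  by apply: le_measure; rewrite ?inE//; apply: open_measurable_rV; exact: ball_open.
by rewrite lebesgue_rV_ball// ltry.
Qed.

Lemma bounded_thickening A e : 0 < e -> bounded_set A ->
  (leb (thickening A e) < +oo)%E.
Proof.
move=> e0 /bounded_sub_ball[M M0 AM].
apply: (@le_lt_trans _ _ (leb (ball 0 (M + e)))); last first.
  by rewrite lebesgue_rV_ball ?addr_gt0// ltry.
apply: le_measure; rewrite ?inE; first exact: measurable_thickening.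
  by apply: open_measurable_rV; exact: ball_open.
by move=> x [a /AM Ma ax]; exact: ball_triangle Ma ax.
Qed.

Lemma measurable_boundary A : measurable (boundary A).
Proof.
apply: measurableD; first by apply: closed_measurable_rV; exact: closed_closure.
by apply: open_measurable_rV; exact: open_interior.
Qed.

Lemma closure_interior_boundary A : closure A = A° `|` boundary A.
Proof.
rewrite setDUK//; apply: subset_trans (@subset_closure _ A).
exact: interior_subset.
Qed.

Lemma lebesgue_closure A : measurable A -> leb (boundary A) = 0%E ->
  leb (closure A) = leb A.
Proof.
move=> mA A0; apply/eqP; rewrite eq_le; apply/andP; split; last first.
  apply: le_measure; rewrite ?inE//; last exact: subset_closure.
  by apply: closed_measurable_rV; exact: closed_closure.
rewrite closure_interior_boundary.
rewrite measureU0//; last first.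
- exact: measurable_boundary.
- by apply: open_measurable_rV; exact: open_interior.
apply: le_measure; rewrite ?inE//; last exact: interior_subset.
by apply: open_measurable_rV; exact: open_interior.
Qed.

Lemma lebesgue_interior A : measurable A -> leb (boundary A) = 0%E ->
  leb A° = leb A.
Proof.
move=> mA A0; rewrite -(lebesgue_closure mA A0).
rewrite closure_interior_boundary.
rewrite measureU0//; first by apply: open_measurable_rV; exact: open_interior.
exact: measurable_boundary.
Qed.

(** These index the cells meeting [A]. Here and in [inner_cells], [fset_set] would give the empty
    set on an infinite set; this is excluded when [A] is bounded and [rho] positive. *)
Definition outer_cells (rho : R) A : {fset 'rV[int]_d} := fset_set (cell_index rho @` A).

Definition inner_cells (rho : R) A : {fset 'rV[int]_d} :=
  fset_set [set k | cell rho k `<=` A].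

Lemma cell_nonempty (rho : R) (k : 'rV[int]_d) : 0 < rho ->
  cell rho k (\row_i (rho * (k ord0 i)%:~R)).
Proof.
move=> rho0 i; rewrite mxE in_itv/= lexx intrD mulrDr ltrDl.
by rewrite mulr1.
Qed.

(** An inner cell contains its lower corner, so its index is that of a point of [A]. *)
Lemma finite_inner_cells rho A : 0 < rho -> bounded_set A ->
  finite_set [set k : 'rV[int]_d | cell rho k `<=` A].
Proof.
move=> rho0 bA; apply: sub_finite_set (finite_cell_index rho0 bA) => k /= kA.
exists (\row_i (rho * (k ord0 i)%:~R)); first by apply: kA; exact: cell_nonempty.
by apply/cellP => //; exact: cell_nonempty.
Qed.

Lemma inner_cells_le rho A : 0 < rho -> bounded_set A -> measurable A ->
  #|` inner_cells rho A|%:R * rho ^+ d <= fine (leb A).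
Proof.
move=> rho0 bA mA; have finD := finite_inner_cells rho0 bA.
rewrite -lee_fin fineK; last by rewrite ge0_fin_numE// lebesgue_bounded.
rewrite -lebesgue_bigcup_cell//; apply: le_measure; rewrite ?inE//.
  by apply: fin_bigcup_measurable => // k _; exact: measurable_cell.
by apply: bigcup_sub.
Qed.

(** The cells meeting [A] lie in its thickening by [rho]. The thickenings by 1/(n + 1) decrease to
    the closure, which has the measure of [A] since the boundary is null. *)
Lemma outer_cells_le A e : bounded_set A -> measurable A ->
    leb (boundary A) = 0%E -> 0 < e ->
  exists2 rho0, 0 < rho0 & forall rho, 0 < rho -> rho <= rho0 ->
    #|` outer_cells rho A|%:R * rho ^+ d <= fine (leb A) + e.
Proof.
move=> bA mA A0 e0.
have finA : leb A \is a fin_num by rewrite ge0_fin_numE// lebesgue_bounded.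
have cvgA : leb (thickening A n.+1%:R^-1) @[n --> \oo] --> leb A.
  rewrite -(lebesgue_closure mA A0) closure_thickening.
  apply: nonincreasing_cvg_mu.
  - exact: bounded_thickening.
  - by move=> n; exact: measurable_thickening.
  - by rewrite -closure_thickening; apply: closed_measurable_rV; exact: closed_closure.
  - move=> m n mn; apply/subsetPset; apply: subset_bigcup => a _ /=.
    by apply: le_ball; rewrite lef_pV2 ?posrE// ler_nat.
have /cvgA[N _ /(_ N (leqnn N))/= NA] :
    nbhs (leb A) [set y | (y < leb A + e%:E)%E].
  apply: open_nbhs_nbhs; split; first exact: open_ereal_lt_ereal.
  by rewrite /= lteDl.
exists N.+1%:R^-1 => // rho rho0 rhoN.
rewrite -lee_fin EFinD fineK// -lebesgue_bigcup_cell//; last exact: finite_cell_index.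
apply: le_trans (ltW NA); apply: le_measure; rewrite ?inE.
- apply: fin_bigcup_measurable; first exact: finite_cell_index.
  by move=> k _; exact: measurable_cell.
- exact: measurable_thickening.
- move=> x [_ [a Aa <-]] ax; exists a => //; apply: (le_ball rhoN).
  exact: cell_ball (cell_cell_index rho0 a) ax.
Qed.

(** A cell of side at most 1/(N + 1) through a point at sup distance at least 1/(N + 1) from the
    complement stays in [A]; such points exhaust the interior as [N] grows. *)
Lemma inner_cells_ge A e : bounded_set A -> measurable A ->
    leb (boundary A) = 0%E -> 0 < e ->
  exists2 rho0, 0 < rho0 & forall rho, 0 < rho -> rho <= rho0 ->
    fine (leb A) - e <= #|` inner_cells rho A|%:R * rho ^+ d.
Proof.
move=> bA mA A0 e0.
have finA : leb A \is a fin_num by rewrite ge0_fin_numE// lebesgue_bounded.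
have intA : A° = \bigcup_n ~` thickening (~` A) n.+1%:R^-1.
  by rewrite -setC_bigcap -closure_thickening -interiorC setCK.
have cvgA : leb (~` thickening (~` A) n.+1%:R^-1) @[n --> \oo] --> leb A.
  rewrite -(lebesgue_interior mA A0) intA.
  apply: nondecreasing_cvg_mu.
  - by move=> n; apply: measurableC; exact: measurable_thickening.
  - by rewrite -intA; apply: open_measurable_rV; exact: open_interior.
  - move=> m n mn; apply/subsetPset; apply: subsetC; apply: subset_bigcup => a _ /=.
    by apply: le_ball; rewrite lef_pV2 ?posrE// ler_nat.
have /cvgA[N _ /(_ N (leqnn N))/= NA] :
    nbhs (leb A) [set y | (leb A - e%:E < y)%E].
  apply: open_nbhs_nbhs; split; first exact: open_ereal_gt_ereal.
  by rewrite /= -(fineK finA) -EFinB lte_fin ltrBlDr ltrDl.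
exists N.+1%:R^-1 => // rho rho0 rhoN.
rewrite -lee_fin EFinB fineK// -lebesgue_bigcup_cell//; last exact: finite_inner_cells.
apply: le_trans (ltW NA) _; apply: le_measure; rewrite ?inE.
- by apply: measurableC; exact: measurable_thickening.
- apply: fin_bigcup_measurable; first exact: finite_inner_cells.
  by move=> k _; exact: measurable_cell.
- move=> x xN; exists (cell_index rho x); last exact: cell_cell_index.
  move=> y xy; apply: contrapT => Ay; apply: xN; exists y => //.
  by apply: (le_ball rhoN); exact: cell_ball xy (cell_cell_index rho0 x).
Qed.

End counting.

(** * Consequences of graph invariance and almost subadditivity *)

Section functionals.
Context {R : realType} {d : nat}.
Implicit Types (x y c : 'rV[R]_d) (S T Y Z : {fset 'rV[R]_d}).
(* Unqualified, edist is the extended distance of the analysis library. *)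
Local Notation edist := (@Defs.edist R d).

Lemma edistDr x y c : edist (x + c) (y + c) = edist x y.
Proof.
rewrite /Defs.edist; congr Num.sqrt; apply: eq_bigr => i _.
by rewrite !mxE opprD addrACA subrr addr0.
Qed.

Lemma edistxx x : edist x x = 0.
Proof. by rewrite /Defs.edist big1 ?sqrtr0// => i _; rewrite subrr expr0n. Qed.

Lemma coord_le_edist x y i : `|x ord0 i - y ord0 i| <= edist x y.
Proof.
rewrite -sqrtr_sqr ler_sqrt; last by apply: sumr_ge0 => j _; exact: sqr_ge0.
by rewrite (bigD1 i)//= lerDl; apply: sumr_ge0 => j _; exact: sqr_ge0.
Qed.

(** A crude comparison with the sup norm: the sharp factor sqrt d is replaced by d, through d <=
    d^2. *)
Lemma edist_le x y e : (forall i, `|x ord0 i - y ord0 i| <= e) ->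
  edist x y <= e * d%:R.
Proof.
(* For [d = 0] the hypothesis is void and [e] may be negative, but both sides vanish. *)
case: (posnP d) x y => [->|d0] x y xy.
  by rewrite /Defs.edist big_ord0 sqrtr0 mulr0.
have e0 : 0 <= e by apply: le_trans (xy (Ordinal d0)).
rewrite -[leRHS]ger0_norm ?mulr_ge0// -sqrtr_sqr ler_sqrt; last exact: sqr_ge0.
apply: (@le_trans _ _ (\sum_(i < d) e ^+ 2)).
  by apply: ler_sum => i _; rewrite -real_normK ?num_real// lerXn2r ?nnegrE.
rewrite sumr_const card_ord exprMn -[leLHS]mulr_natr ler_wpM2l ?sqr_ge0//.
by rewrite -natrX ler_nat leq_pmulr.
Qed.

Variable zeta : {fset 'rV[R]_d} -> R.

Hypothesis zeta_fset0 : zeta fset0 = 0.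
Hypothesis zeta_inv : graph_invariant zeta.

(** Adjacency means distinct and at distance at most 1, so the two hypotheses make [phi] a graph
    isomorphism from [S] onto its image. This serves translations, contractions and perturbations
    alike. *)
Lemma graph_invariant_imfset (phi : 'rV[R]_d -> 'rV[R]_d) S :
    {in S &, injective phi} ->
    {in S &, forall x y, (edist (phi x) (phi y) <= 1) = (edist x y <= 1)} ->
  zeta [fset phi x | x in S]%fset = zeta S.
Proof.
move=> phi_inj phi_adj; apply/esym/zeta_inv.
have phiS (u : S) : phi (val u) \in [fset phi x | x in S]%fset.
  by apply/imfsetP; exists (val u) => //; exact: valP.
pose g (u : S) := [` phiS u]%fset.
have g_inj : injective g.
  move=> u v /(congr1 val)/= uv; apply: val_inj.
  by apply: phi_inj uv; exact: valP.
exists g; split.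
  by apply: inj_card_bij => //; rewrite -!cardfE card_in_imfset.
move=> u v; rewrite /geom_adj (inj_eq g_inj) phi_adj//; exact: valP.
Qed.

Lemma graph_invariant_translate c S :
  zeta [fset (c + x)%R | x in S]%fset = zeta S.
Proof.
apply: graph_invariant_imfset => [x y _ _|x y _ _]; last first.
  by rewrite ![c + _]addrC edistDr.
exact: addrI.
Qed.

Definition cell_center (rho : R) (k : 'rV[int]_d) : 'rV[R]_d :=
  \row_i (rho * ((k ord0 i)%:~R + 2^-1)).

Lemma cell_cube rho k x : cell rho k x <-> cube rho (x - cell_center rho k).
Proof.
by split=> xk i; have := xk i; rewrite !in_itv/= !mxE intrD; lra.
Qed.

(** Every cell is a translate of the centred cube, and translations preserve the graph. *)
Lemma cell_bound rho B : 
    (forall S, [set` S] `<=` cube rho -> zeta S <= B) ->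
  forall S k, [set` S] `<=` cell rho k -> zeta S <= B.
Proof.
move=> SB S k Sk; rewrite -(graph_invariant_translate (- cell_center rho k)).
apply: SB => _ /= /imfsetP[x xS ->]; rewrite addrC; apply/cell_cube.
exact: Sk.
Qed.

(** Induction on the list of cells: splitting off the points of one cell costs at most [B + c], and
    the empty set left at the end costs nothing. *)
Lemma cover_bound (rho B c : R) (K : {fset 'rV[int]_d}) S : 0 < rho ->
    (forall Y Z, [disjoint Y & Z]%fset ->
      zeta (Y `|` Z)%fset <= zeta Y + zeta Z + c) ->
    (forall T k, [set` T] `<=` cell rho k -> zeta T <= B) ->
    (forall x, x \in S -> cell_index rho x \in K) ->
  zeta S <= #|` K|%:R * (B + c).
Proof.
move=> rho0 subadd TB SK.
have {SK} : forall x, x \in S -> cell_index rho x \in enum_fset K by [].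
elim: (enum_fset K) S => [|k s IH] S SK.
  rewrite mul0r (_ : S = fset0) ?zeta_fset0//.
  by apply/fsetP => x; rewrite inE; apply/negP => /SK.
pose Y := [fset x in S | cell_index rho x == k]%fset.
pose Z := [fset x in S | cell_index rho x != k]%fset.
have -> : S = (Y `|` Z)%fset.
  by apply/fsetP => x; rewrite !inE/=; case: (x \in S) => //=; case: eqP.
apply: (le_trans (subadd _ _ _)).
  apply/fdisjointP => x; rewrite !inE/= => /andP[_ ->].
  by rewrite andbF.
rewrite [X in X%:R]/= -natr1 mulrDl mul1r addrC [leRHS]addrC addrA [c + _]addrC.
rewrite lerD//; last first.
  apply: IH => x; rewrite !inE/= => /andP[/SK + xk].
  by rewrite inE (negbTE xk).
rewrite lerD2r; apply: (TB _ k) => x; rewrite /= !inE/= => /andP[_ /eqP].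
by move/cellP; exact.
Qed.

End functionals.

(** * The limit of the normalised supremum over large cubes, by a Fekete argument *)

Section scaling_limit.
Context {R : realType} {d : nat}.
Implicit Types (S T Y Z : {fset 'rV[R]_d}).
Local Notation leb := (lebesgue_rV R d).

Lemma cvg_exprn (T : Type) (F : set_system T) (FF : Filter F) (u : T -> R) (a : R) n :
  u t @[t --> F] --> a -> u t ^+ n @[t --> F] --> a ^+ n.
Proof.
move=> ua; elim: n => [|n IH]; first exact: cvg_cst.
rewrite exprS (_ : (fun t => u t ^+ n.+1) = u \* (fun t => u t ^+ n)).
  exact: cvgM.
by apply/funext => t; rewrite exprS.
Qed.

Lemma cvg_invDr_pinfty (a : R) : (t + a)^-1 @[t --> +oo] --> 0.
Proof.
apply/(gtr0_cvgV0 (f := fun t => t + a)); last exact: cvg_addrr.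
near=> t; rewrite -ltrBlDr sub0r; near: t.
by apply: nbhs_pinfty_gt; rewrite num_real.
Unshelve. all: by end_near. Qed.

Lemma bounded_cube (s : R) : 0 < s -> bounded_set (cube (n := d) s).
Proof.
move=> s0; exists s; split; first exact: num_real.
move=> M sM x /= xs; apply: ltW; apply: le_lt_trans sM.
have : ball (0 : 'rV[R]_d) s x.
  apply/ball_rVP => // i; have := xs i; rewrite in_itv/= mxE sub0r normrN.
  by move=> /andP[x1 x2]; rewrite ltr_norml; lra.
by rewrite mx_norm_ball /ball_/= sub0r normrN => /ltW.
Qed.

(** The cells are disjoint and contained in the cube of side [t + 2 * s]; compare volumes. *)
Lemma outer_cells_cube (s t : R) : 0 < s -> 0 < t ->
  #|` outer_cells s (cube (n := d) t)|%:R * s ^+ d <= (t + 2 * s) ^+ d.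
Proof.
move=> s0 t0; have fin := finite_cell_index s0 (bounded_cube t0).
have ts0 : 0 <= t + 2 * s by rewrite addr_ge0 ?mulr_ge0// ltW.
have itvE (i : 'I_d) : lebesgue_measure
    ([set` `[- ((t + 2 * s) / 2), (t + 2 * s) / 2[] : set R) = (t + 2 * s)%:E.
  rewrite lebesgue_measure_itv/= lte_fin ifT; last by lra.
  by rewrite -EFinB; congr EFin; lra.
rewrite -lee_fin -lebesgue_bigcup_cell// -(lebesgue_rV_itv_box ts0 itvE).
apply: le_measure; rewrite ?inE.
- by apply: fin_bigcup_measurable => // k _; exact: measurable_cell.
- exact: measurable_itv_box.
- move=> x [_ [y yt <-]] xy i.
  have /ball_rVP := cell_ball s0 xy (cell_cell_index s0 y).
  move=> /(_ s0 i); have := yt i; rewrite !in_itv/= ltr_norml.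
  by move=> /andP[y1 y2] /andP[x1 x2]; lra.
Qed.

Variable zeta : {fset 'rV[R]_d} -> R.

Hypothesis zeta_fset0 : zeta fset0 = 0.
Hypothesis zeta_inv : graph_invariant zeta.
Hypothesis zeta_bnd : bounded_on_half_ball zeta.

Variable c : R.
Hypothesis c_ge0 : 0 <= c.
Hypothesis zeta_subadd : forall Y Z, [disjoint Y & Z]%fset ->
  zeta (Y `|` Z)%fset <= zeta Y + zeta Z + c.

(** With side 1/(d + 1), points of the cube have Euclidean norm at most d / (2 (d + 1)) <= 1/2, so
    the half-ball bound applies. *)
Lemma small_cube_bound : exists B, forall S,
  [set` S] `<=` cube (d.+1%:R^-1 : R) -> zeta S <= B.
Proof.
move: zeta_bnd; rewrite /bounded_on_half_ball; set E := (X in ereal_sup X).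
move=> supE; exists (fine (ereal_sup E)) => S S1.
have zS T : [set` T] `<=` closed_eball 0 (1 / 2) -> (`|zeta T|%:E <= ereal_sup E)%E.
  by move=> T1; apply: ereal_sup_ubound; exists T.
rewrite -lee_fin fineK.
  apply: (@le_trans _ _ `|zeta S|%:E); first by rewrite lee_fin ler_norm.
  apply: zS => x /S1 xc.
  apply: (le_trans (edist_le (e := d.+1%:R^-1 / 2) _)).
    move=> i; have := xc i; rewrite in_itv/= mxE sub0r normrN ler_norml.
    by move=> /andP[-> /ltW->].
  rewrite mulrAC ler_pM2r ?invr_gt0// mulrC ler_pdivrMr// mul1r.
  by rewrite ler_nat.
rewrite ge0_fin_numE//; apply: le_trans (zS fset0 _) => //.
Qed.

Lemma cube_bound (t : R) : 0 < t ->
  exists B, forall S, [set` S] `<=` cube t -> zeta S <= B.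
Proof.
move=> t0; have [B SB] := small_cube_bound.
have d0 : 0 < d.+1%:R^-1 :> R by rewrite invr_gt0.
exists (#|` outer_cells d.+1%:R^-1 (cube (n := d) t)|%:R * (B + c)) => S St.
apply: (cover_bound zeta_fset0 (rho := d.+1%:R^-1)) => //; first exact: cell_bound.
move=> x xS; rewrite in_fset_set; last exact/finite_cell_index/bounded_cube.
by rewrite inE; exists x => //; exact: St.
Qed.

Definition cube_sup (t : R) := fine (zeta_star zeta (cube t)).

Lemma fin_zeta_star (t : R) : 0 < t -> zeta_star zeta (cube t) \is a fin_num.
Proof.
move=> /cube_bound[B SB]; rewrite ge0_fin_numE.
  apply: (@le_lt_trans _ _ B%:E); last exact: ltry.
  by apply: ge_ereal_sup => _ [S /= St <-]; rewrite lee_fin; exact: SB.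
by apply: ereal_sup_ubound; exists fset0; rewrite /= ?zeta_fset0.
Qed.

Lemma cube_sup_ge (t : R) S : 0 < t -> [set` S] `<=` cube t ->
  zeta S <= cube_sup t.
Proof.
move=> t0 St; rewrite -lee_fin fineK ?fin_zeta_star//.
by apply: ereal_sup_ubound; exists S.
Qed.

Lemma cube_sup_adherent (t e : R) : 0 < t -> 0 < e ->
  exists2 S, [set` S] `<=` cube t & cube_sup t - e < zeta S.
Proof.
move=> t0 e0; have := fin_zeta_star t0.
have : ((cube_sup t - e)%:E < zeta_star zeta (cube t))%E.
  by rewrite -[ltRHS]fineK ?fin_zeta_star// lte_fin ltrBlDr ltrDl.
by move=> /ereal_sup_gt[_ [S /= St <-]]; rewrite lte_fin => ? _; exists S.
Qed.

Lemma cube_sup_ge0 (t : R) : 0 < t -> 0 <= cube_sup t.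
Proof. by move=> t0; rewrite -zeta_fset0; exact: cube_sup_ge. Qed.

(** The limit is written as an infimum, as in Fekete's lemma; adding [c] absorbs the constant paid
    per cell in [cover_bound]. *)
Definition scaling_rate : R :=
  inf [set (cube_sup s + c) / s ^+ d | s in [set s | 0 < s]].

Lemma scaling_rate_le (s : R) : 0 < s ->
  scaling_rate <= (cube_sup s + c) / s ^+ d.
Proof.
move=> s0; apply: ge_inf; last by exists s.
exists 0 => _ [t /= t0 <-].
by rewrite divr_ge0// ?exprn_ge0 ?addr_ge0 ?cube_sup_ge0// ltW.
Qed.

Lemma scaling_rate_ge0 : 0 <= scaling_rate.
Proof.
apply: lb_le_inf; first by exists ((cube_sup 1 + c) / 1 ^+ d); exists 1 => /=.
move=> _ [t /= t0 <-].
by rewrite divr_ge0// ?exprn_ge0 ?addr_ge0 ?cube_sup_ge0// ltW.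
Qed.

Lemma scaling_rate_adherent (e : R) : 0 < e ->
  exists2 s, 0 < s & (cube_sup s + c) / s ^+ d < scaling_rate + e.
Proof.
move=> e0; have [] := @inf_adherent R
    [set (cube_sup s + c) / s ^+ d | s in [set s | 0 < s]] e e0.
  split; first by exists ((cube_sup 1 + c) / 1 ^+ d); exists 1 => /=.
  exists 0 => _ [t /= t0 <-].
  by rewrite divr_ge0// ?exprn_ge0 ?addr_ge0 ?cube_sup_ge0// ltW.
by move=> _ [s /= s0 <-] ?; exists s.
Qed.

(** The cube of side [t] is covered by cells of side [s], each costing [cube_sup s + c];
    [outer_cells_cube] bounds their number. *)
Lemma cube_sup_le (s t : R) : 0 < s -> 0 < t ->
  cube_sup t / t ^+ d <= (1 + 2 * s * t^-1) ^+ d * ((cube_sup s + c) / s ^+ d).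
Proof.
move=> s0 t0.
have -> : 1 + 2 * s * t^-1 = (t + 2 * s) / t.
  by field; rewrite gt_eqF.
rewrite expr_div_n mulrAC ler_pM2r ?invr_gt0 ?exprn_gt0//.
have B0 : 0 <= cube_sup s + c by rewrite addr_ge0// cube_sup_ge0.
apply: (@le_trans _ _ (#|` outer_cells s (cube (n := d) t)|%:R * (cube_sup s + c))).
  rewrite -lee_fin fineK ?fin_zeta_star//.
  apply: ge_ereal_sup => _ [S /= St <-]; rewrite lee_fin.
  apply: (cover_bound zeta_fset0 (rho := s)) => //.
    by apply: cell_bound => // T Ts; exact: cube_sup_ge.
  move=> x xS; rewrite in_fset_set; last exact/finite_cell_index/bounded_cube.
  by rewrite inE; exists x => //; exact: St.
rewrite mulrA ler_pdivlMr ?exprn_gt0// mulrAC.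
by rewrite ler_wpM2r//; exact: outer_cells_cube.
Qed.

Hypothesis d_gt0 : (0 < d)%N.

(** False for [d = 0]; this decay is what removes additive constants from the limit. *)
Lemma cvg_inv_exprn (a : R) : (t + a) ^- d @[t --> +oo] --> 0.
Proof.
rewrite (_ : 0 = 0 ^+ d); last by rewrite expr0n eqn0Ngt d_gt0.
rewrite (_ : (fun t => _) = (fun t : R => (t + a)^-1 ^+ d)); last first.
  by apply/funext => t; rewrite exprVn.
by apply: cvg_exprn; exact: cvg_invDr_pinfty.
Qed.

(** From below, the infimum bounds every term up to c / t^d. From above, a nearly minimising [s] is
    fixed in [cube_sup_le], where the factor (1 + 2s/t)^d tends to 1. *)
Lemma cvg_cube_sup : cube_sup t / t ^+ d @[t --> +oo] --> scaling_rate.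
Proof.
apply/cvgrPdist_le => e e0.
have [s s0 sL] := scaling_rate_adherent (divr_gt0 e0 (ltr0n R 2)).
set a := (cube_sup s + c) / s ^+ d in sL.
have low : \forall t \near +oo, scaling_rate - e <= cube_sup t / t ^+ d.
  have : c * (t + 0) ^- d @[t --> +oo] --> c * 0.
    by apply: cvgMr; exact: cvg_inv_exprn.
  move=> /cvgr_le /(_ e); rewrite mulr0 => /(_ e0) He.
  near=> t; have t0 : 0 < t by near: t; exact: nbhs_pinfty_gt.
  have := scaling_rate_le t0; rewrite mulrDl => h.
  have : c * (t + 0) ^- d <= e by near: t.
  by rewrite addr0; lra.
have upp : \forall t \near +oo, cube_sup t / t ^+ d <= scaling_rate + e.
  have : (1 + 2 * s * t^-1) ^+ d * a @[t --> +oo] --> (1 + 2 * s * 0) ^+ d * a.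
    apply: cvgMl; apply: cvg_exprn; apply: cvgD; first exact: cvg_cst.
    apply: cvgMr; have := @cvg_invDr_pinfty 0.
    by under eq_fun do rewrite addr0.
  move=> /cvgr_le /(_ (scaling_rate + e)); rewrite mulr0 addr0 expr1n mul1r.
  move=> He; have {}He := He ltac:(lra).
  near=> t; have t0 : 0 < t by near: t; exact: nbhs_pinfty_gt.
  by apply: (le_trans (cube_sup_le s0 t0)); near: t.
near=> t; rewrite distrC ler_distl; apply/andP; split; near: t.
  exact: low.
exact: upp.
Unshelve. all: by end_near. Qed.

Lemma zeta_barE : zeta_bar zeta = scaling_rate%:E.
Proof.
apply: cvg_lim; first exact: ereal_hausdorff.
apply: cvg_EFin.
  near=> t; have t0 : 0 < t by near: t; exact: nbhs_pinfty_gt.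
  by rewrite fin_numM// fin_zeta_star.
apply: cvg_trans cvg_cube_sup; apply: near_eq_cvg; near=> t.
have t0 : 0 < t by near: t; exact: nbhs_pinfty_gt.
by rewrite /= fineM ?fin_zeta_star//= mulrC.
Unshelve. all: by end_near. Qed.

(** The normalisation uses side [s + 2]: a margin of 1 around the cube will separate copies in
    neighbouring cells, at the price of a factor (s / (s + 2))^d tending to 1. *)
Lemma near_optimal_configuration (e : R) : 0 < e -> exists s S,
  [/\ 0 < s, [set` S] `<=` cube s & scaling_rate - e <= zeta S / (s + 2) ^+ d].
Proof.
move=> e0.
have : (1 - 2 * (s + 2)^-1) ^+ d * scaling_rate - (c + 1) * (s + 2) ^- d
    @[s --> +oo] --> (1 - 2 * 0) ^+ d * scaling_rate - (c + 1) * 0.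
  apply: cvgB; last by apply: cvgMr; exact: cvg_inv_exprn.
  apply: cvgMl; apply: cvg_exprn; apply: cvgB; first exact: cvg_cst.
  by apply: cvgMr; exact: cvg_invDr_pinfty.
move=> /cvgr_ge /(_ (scaling_rate - e)).
rewrite !mulr0 !subr0 expr1n mul1r ltrBlDr ltrDl => /(_ e0) He.
have [s [s0 sL]] : exists s, 0 < s /\ scaling_rate - e <=
    (1 - 2 * (s + 2)^-1) ^+ d * scaling_rate - (c + 1) * (s + 2) ^- d.
  apply: (@filter_ex _ +oo%R); near=> s; split; near: s => //.
  exact: nbhs_pinfty_gt.
(* The slack 1 allowed here and the constant [c] make up the [c + 1] above. *)
have [S Ss zS] := cube_sup_adherent s0 ltr01.
exists s, S; split => //; apply: (le_trans sL).
have s20 : 0 < s + 2 by rewrite addr_gt0.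
rewrite (_ : 1 - 2 * (s + 2)^-1 = s / (s + 2)); last first.
  by field; rewrite gt_eqF.
rewrite expr_div_n mulrAC -mulrBl ler_pM2r ?invr_gt0 ?exprn_gt0//.
have := scaling_rate_le s0; rewrite ler_pdivlMr ?exprn_gt0// mulrC.
by lra.
Unshelve. all: by end_near. Qed.

End scaling_limit.

(** * Configurations stable under perturbation, and superadditivity over separated cells *)

Section robust_configurations.
Context {R : realType} {d : nat}.
Implicit Types (x y u v : 'rV[R]_d) (S T Y Z W : {fset 'rV[R]_d}).
Local Notation edist := (@Defs.edist R d).

(** The squared distance is polynomial and has the same threshold 1 as [edist]. *)
Definition sqdist x y : R := \sum_(i < d) (x ord0 i - y ord0 i) ^+ 2.

Lemma sqdist_ge0 x y : 0 <= sqdist x y.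
Proof. by apply: sumr_ge0 => i _; exact: sqr_ge0. Qed.

Lemma sqdist_gt0 x y : (0 < sqdist x y) = (x != y).
Proof.
rewrite lt_neqAle sqdist_ge0 andbT eq_sym; congr negb.
apply/eqP/eqP => [xy|->]; last first.
  by apply: big1 => i _; rewrite subrr expr0n.
apply/rowP => i; apply/eqP; rewrite -subr_eq0 -sqrf_eq0.
by have /psumr_eq0P/= := xy; move=> /(_ (fun j _ => sqr_ge0 _)) /(_ i isT) ->.
Qed.

Lemma edist_le1 x y : (edist x y <= 1) = (sqdist x y <= 1).
Proof. by rewrite -[1 in LHS]sqrtr1 ler_sqrt. Qed.

Lemma sqdistZ a x y : sqdist (a *: x) (a *: y) = a ^+ 2 * sqdist x y.
Proof.
by rewrite /sqdist mulr_sumr; apply: eq_bigr => i _; rewrite !mxE -mulrBr exprMn.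
Qed.

(** In each coordinate |p^2 - q^2| = |p - q| |p + q|, with |p - q| <= 2e and |p + q| <= 2M + 2e <=
    2M + 2. *)
Lemma sqdist_perturb u v x y e M : 0 <= e -> e <= 1 ->
    (forall i, `|x ord0 i - u ord0 i| <= e) ->
    (forall i, `|y ord0 i - v ord0 i| <= e) ->
    (forall i, `|x ord0 i - y ord0 i| <= M) ->
  `|sqdist u v - sqdist x y| <= d%:R * (e * (4 * M + 4)).
Proof.
move=> e0 e1 xu yv xy; rewrite /sqdist -sumrB.
apply: (le_trans (ler_norm_sum _ _ _)).
apply: (@le_trans _ _ (\sum_(i < d) (e * (4 * M + 4)))); last first.
  by rewrite sumr_const card_ord -[leLHS]mulr_natl.
apply: ler_sum => i _; rewrite subr_sqr normrM.
rewrite (_ : e * _ = 2 * e * (2 * M + 2)); last by ring.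
have := xu i; have := yv i; have := xy i; rewrite !ler_norml.
move=> /andP[h1 h2] /andP[h3 h4] /andP[h5 h6].
by apply: ler_pM => //; rewrite ler_norml; lra.
Qed.

(** Used with [b = 1] for squared distances of non-adjacent pairs and with [b = 0] for those of
    distinct points. *)
Lemma finite_gap (b : R) (s : seq R) :
  exists2 m, b < m & forall t, t \in s -> b < t -> m <= t.
Proof.
elim: s => [|t s [m bm ms]]; first by exists (b + 1) => //; rewrite ltrDl.
have [bt|tb] := ltP b t; last first.
  by exists m => // u; rewrite inE => /predU1P[->|/ms//]; rewrite ltNge tb.
exists (Num.min t m); first by rewrite lt_min bt.
move=> u; rewrite inE => /predU1P[->|us bu]; first by rewrite ge_min lexx.
by rewrite ge_min (ms _ us bu) orbT.
Qed.

Variable zeta : {fset 'rV[R]_d} -> R.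
Hypothesis zeta_inv : graph_invariant zeta.

(* Pairs at distance exactly 1 are not stable under perturbation, so the
   configuration is first contracted slightly, which preserves its graph. *)
Lemma robust_configuration (s : R) S : 0 < s -> [set` S] `<=` cube s ->
  exists S' (eta : R), [/\ 0 < eta <= 4^-1, [set` S'] `<=` cube s &
    forall phi : 'rV[R]_d -> 'rV[R]_d,
      (forall x, x \in S' -> ball x eta (phi x)) ->
      zeta [fset phi x | x in S']%fset = zeta S].
Proof.
move=> s0 Ss.
have [m m1 Sm] := finite_gap 1 [seq sqdist x y | x <- S, y <- S].
(* Contraction by 1 - a then leaves a gap a on both sides of 1: (1 - a)^2 <= 1 - a, and (1 - a)^2 m
   >= m - 2am = (m + 1)/2 >= 1 + a. *)
pose a := (m - 1) / (4 * m).
have am : 4 * m * a = m - 1 by rewrite /a; field; rewrite gt_eqF//; lra.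
have a0 : 0 < a by rewrite divr_gt0//; lra.
have a1 : a < 1 by rewrite /a ltr_pdivrMr//; lra.
have a20 : 0 <= a ^+ 2 by exact: sqr_ge0.
have a2a : a ^+ 2 <= a by rewrite expr2; nra.
have lam2 : (1 - a) ^+ 2 = 1 - 2 * a + a ^+ 2 by ring.
pose lam x := (1 - a) *: x.
have lamI : injective lam.
  by apply: scalerI; rewrite subr_eq0 gt_eqF.
pose S' := [fset lam x | x in S]%fset.
have [m' m'0 Sm'] := finite_gap 0 [seq sqdist x y | x <- S', y <- S'].
have gap x y : x \in S -> y \in S ->
    sqdist (lam x) (lam y) <= 1 - a /\ sqdist x y <= 1 \/
    1 + a <= sqdist (lam x) (lam y) /\ 1 < sqdist x y.
  move=> xS yS; rewrite sqdistZ lam2; have := sqdist_ge0 x y.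
  have [xy1 xy0|xy1 _] := leP (sqdist x y) 1; [left|right].
    by split=> //; nra.
  split=> //; have mxy : m <= sqdist x y.
    by apply: Sm => //; apply/allpairsP; exists (x, y).
  apply: (@le_trans _ _ ((1 - 2 * a + a ^+ 2) * m)).
    by nra.
  by rewrite ler_pM2l//; nra.
(* A change of squared distances by less than [a] preserves adjacency, and by less than [m'] keeps
   points distinct. *)
pose w := Num.min a m'.
have w0 : 0 < w by rewrite lt_min a0.
(* By [sqdist_perturb] with M = s the change is at most d eta (4s + 4); using d + 1 in place of d
   makes it strictly less than [w]. The cap 1/4 keeps copies in different cells apart later. *)
pose eta := Num.min 4^-1 (w / ((d%:R + 1) * (4 * s + 4))).
have D0 : 0 < (d%:R + 1) * (4 * s + 4).
  by rewrite mulr_gt0// ?ltr_wpDl//; lra.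
have eta0 : 0 < eta by rewrite lt_min invr_gt0 ltr0n/= divr_gt0.
have eta4 : eta <= 4^-1 by rewrite ge_min lexx.
have S'lam x : x \in S' -> exists2 z, z \in S & x = lam z.
  by move=> /imfsetP[z zS ->]; exists z.
have S's : [set` S'] `<=` cube s.
  move=> _ /= /S'lam[x /Ss xs ->] i; have := xs i; rewrite !in_itv/= !mxE.
  by move=> /andP[x1 x2]; apply/andP; split; nra.
have pert u v x y : x \in S' -> y \in S' -> ball x eta u -> ball y eta v ->
    `|sqdist u v - sqdist x y| < w.
  move=> xS yS /ball_rVP - /(_ eta0) xu /ball_rVP - /(_ eta0) yv.
  apply: (@le_lt_trans _ _ (d%:R * (eta * (4 * s + 4)))).
    apply: sqdist_perturb => [||i|i|i]; first exact: ltW.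
    - by apply: le_trans eta4 _; lra.
    - by apply: ltW.
    - by apply: ltW.
    - have := S's _ xS i; have := S's _ yS i; rewrite !in_itv/= ler_norml.
      by move=> /andP[h1 h2] /andP[h3 h4]; lra.
  apply: (@lt_le_trans _ _ ((d%:R + 1) * (eta * (4 * s + 4)))).
    by rewrite ltr_pM2r ?ltrDl// mulr_gt0//; lra.
  rewrite mulrCA -ler_pdivlMr//.
  by rewrite ge_min lexx orbT.
exists S', eta; split; [by rewrite eta0 eta4|exact: S's|].
move=> phi hphi.
have lamS : zeta S' = zeta S.
  apply: (graph_invariant_imfset zeta_inv) => [x y _ _ /lamI//|x y xS yS].
  rewrite !edist_le1.
  by have [[h1 h2]|[h1 h2]] := gap _ _ xS yS; apply/idP/idP => h; lra.
rewrite -lamS; apply: (graph_invariant_imfset zeta_inv) => x y xS yS.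
  move=> pxy; apply/eqP; apply: contraPT isT => xy.
  have := pert _ _ _ _ xS yS (hphi _ xS) (hphi _ yS); rewrite pxy.
  have -> : sqdist (phi y) (phi y) = 0.
    by apply: big1 => i _; rewrite subrr expr0n.
  rewrite sub0r normrN ger0_norm ?sqdist_ge0// lt_min => /andP[_].
  rewrite ltNge Sm'// ?sqdist_gt0//.
  by apply/allpairsP; exists (x, y).
rewrite !edist_le1.
have := pert _ _ _ _ xS yS (hphi _ xS) (hphi _ yS).
rewrite lt_min ltr_norml => /andP[/andP[h1 h2] _].
have [x' x'S ex] := S'lam _ xS; have [y' y'S ey] := S'lam _ yS.
have := gap _ _ x'S y'S; rewrite -ex -ey.
by move=> [[h3 _]|[h3 _]]; apply/idP/idP => h; lra.
Qed.

Hypothesis zeta_incr : increasing_functional zeta.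
Hypothesis zeta_superadd : superadditive_up_to_boundary zeta.
Hypothesis zeta_fset0 : zeta fset0 = 0.

(** Recentring at the centre of the cell and dividing by [r] turns this set into [ball x eta]. *)
Definition target (rho r eta : R) (k : 'rV[int]_d) x : set 'rV[R]_d :=
  ball (cell_center rho k + r *: x) (r * eta).

Lemma rescaled_ge_good_cells (s r eta z : R) S' (K : {fset 'rV[int]_d}) Y :
    0 < s -> 0 < r -> 0 < eta <= 4^-1 -> [set` S'] `<=` cube s ->
    (forall phi : 'rV[R]_d -> 'rV[R]_d,
      (forall x, x \in S' -> ball x eta (phi x)) ->
      zeta [fset phi x | x in S']%fset = z) ->
    (forall k x, k \in K -> x \in S' ->
      exists2 y, y \in Y & target ((s + 2) * r) r eta k x y) ->
  #|` K|%:R * z <= rescaled zeta r Y.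
Proof.
move=> s0 r0 /andP[eta0 eta4] S's rob hit.
pose rY := [fset r^-1 *: x | x in Y]%fset.
pose c k : 'rV[R]_d := cell_center (s + 2) k.
have rc (k : 'rV[int]_d) : cell_center ((s + 2) * r) k = r *: c k.
  by apply/rowP => i; rewrite !mxE; ring.
(* Induction over the cells: [W] collects the rescaled sample points chosen so far, one per target.
   Their closeness to the cell centres [c k] is carried along to separate different cells. *)
suff : forall t : seq 'rV[int]_d, uniq t -> {subset t <= K} -> exists W,
    [/\ (size t)%:R * z <= zeta W, (W `<=` rY)%fset &
      forall w, w \in W -> exists2 k, k \in t &
        forall i, `|w ord0 i - c k ord0 i| < s / 2 + 4^-1].
  move=> /(_ (enum_fset K) (fset_uniq K) (fun _ => id))[W [zW WY _]].
  apply: (le_trans zW); rewrite /rescaled -/rY -(fsetUidPr _ _ WY).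
  exact: zeta_incr.
elim=> [_ _|k t IH /= /andP[kt ut] tK].
  by exists fset0; rewrite mul0r zeta_fset0 fsub0set; split.
have [|W [zW WY Wt]] := IH ut.
  by move=> l lt; apply: tK; rewrite inE lt orbT.
have kK : k \in K by apply: tK; rewrite inE eqxx.
have [phi hphi] : exists phi : 'rV[R]_d -> 'rV[R]_d, forall x, x \in S' ->
    phi x \in Y /\ target ((s + 2) * r) r eta k x (phi x).
  have /choice[phi hphi] : forall x, exists y, x \in S' ->
      y \in Y /\ target ((s + 2) * r) r eta k x y.
    move=> x; have [xS|] := boolP (x \in S'); last by exists 0.
    by have [y yY xy] := hit _ _ kK xS; exists y.
  by exists phi.
(* Rescaled and recentred, the chosen points are an [eta]-perturbation of [S'], so [rob] applies;
   [W'] is the translate back to cell [k]. *)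
pose psi x := r^-1 *: phi x - c k.
have psiB x : x \in S' -> ball x eta (psi x).
  move=> /hphi[_]; rewrite /target rc => /ball_rVP - /(_ (mulr_gt0 r0 eta0)) h.
  apply/ball_rVP => // i; have := h i; rewrite !mxE.
  rewrite (_ : _ + _ - _ = r * (x ord0 i - (r^-1 * phi x ord0 i -
     (s + 2) * ((k ord0 i)%:~R + 2^-1)))); last by field; rewrite gt_eqF.
  by rewrite normrM (gtr0_norm r0) ltr_pM2l.
pose V := [fset psi x | x in S']%fset.
pose W' := [fset (c k + x)%R | x in V]%fset.
have zW' : zeta W' = z by rewrite graph_invariant_translate// rob.
have W'P w : w \in W' -> exists2 x, x \in S' & w = r^-1 *: phi x.
  move=> /imfsetP[_ /imfsetP[x xS ->] ->]; exists x => //.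
  by rewrite addrC subrK.
have W'k w : w \in W' -> forall i, `|w ord0 i - c k ord0 i| < s / 2 + 4^-1.
  move=> /imfsetP[_ /imfsetP[x xS ->] ->] i.
  have /ball_rVP - /(_ eta0 i) := psiB _ xS.
  rewrite [(c k + _) ord0 i]mxE addrC addKr; move: (psi x ord0 i) => p.
  have := S's _ xS i; rewrite in_itv/= !ltr_norml.
  by move=> /andP[h1 h2] /andP[h3 h4]; apply/andP; split; lra.
(* Centres of distinct cells differ by at least s + 2 in some coordinate, so the distance exceeds s
   + 2 - 2 (s/2 + 1/4) = 3/2. *)
have far w w' : w \in W' -> w' \in W -> 1 < edist w w'.
  move=> /W'k wk /Wt[l lt w'l].
  have /eqP/rowP/existsNP[i /eqP kl] : k != l by apply: contraNN kt => /eqP ->.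
  apply: lt_le_trans (coord_le_edist w w' i).
  have := wk i; have := w'l i; rewrite !mxE !ltr_norml => /andP[h1 h2] /andP[h3 h4].
  rewrite ltr_normr; move: kl; rewrite neq_lt -2!lezD1 -2!(ler_int R) !intrD.
  by move=> /orP[kl|kl]; apply/orP; [right|left]; nra.
have [c2 c20 P4] := zeta_superadd.
have dis : [disjoint W' & W]%fset.
  apply/fdisjointP => w wW'; apply/negP => wW.
  by have := far _ _ wW' wW; rewrite edistxx ltr10.
have near0 : near_points W W' = fset0.
  apply/fsetP => w; rewrite !inE/=; apply/negbTE/negP => /andP[wW' /hasP[w' w'W]].
  by rewrite leNgt far.
exists (W' `|` W)%fset; split.
- have := P4 _ _ dis; rewrite near0 cardfs0 mulr0 subr0 zW'.
  by rewrite [size _]/= -natr1 mulrDl mul1r; lra.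
- apply/fsubsetP => w; rewrite inE => /orP[/W'P[x xS ->]|/(fsubsetP WY)//].
  by apply/imfsetP; exists (phi x) => //; have [] := hphi _ xS.
- move=> w; rewrite inE => /orP[wW'|/Wt[l lt wl]].
    by exists k; [rewrite inE eqxx|exact: W'k].
  by exists l => //; rewrite inE lt orbT.
Qed.

End robust_configurations.

(** * Sets of positive mass that the sample misses: exponential bound and Borel-Cantelli *)

Section missed_sets.
Context {R : realType} {d : nat}.
Implicit Types (A U : set 'rV[R]_d).
Local Notation leb := (lebesgue_rV R d).

Lemma measure_bigsetU_le disp (T : measurableType disp)
    (P : {measure set T -> \bar R}) (I : Type) (s : seq I) (Q : pred I)
    (F : I -> set T) : (forall i, measurable (F i)) ->
  (P (\big[setU/set0]_(i <- s | Q i) F i) <= \sum_(i <- s | Q i) P (F i))%E.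
Proof.
move=> mF; elim: s => [|i s IH]; first by rewrite !big_nil measure0.
rewrite !big_cons; case: ifP => // _.
apply: (le_trans (measureU2 P _ _)) => //.
  by apply: bigsetU_measurable.
by rewrite leeD2l.
Qed.

Variables (mu : probability 'rV[R]_d R) (f : 'rV[R]_d -> R).
Hypothesis f_density : is_density mu f.
Local Notation supp := (f @^-1` `]0, +oo[).

Lemma measurable_preimage_density (I : interval R) :
  measurable (f @^-1` [set` I]).
Proof.
have [mf _ _] := f_density.
by rewrite -[X in measurable X]setTI; apply: mf => //; exact: measurable_itv.
Qed.

Lemma density_supportC : mu (~` supp) = 0%E.
Proof.
have [mf f0 muE] := f_density.
rewrite muE; last by apply: measurableC; exact: measurable_preimage_density.
apply: integral0_eq => x /=; rewrite in_itv/= andbT => /negP.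
by rewrite -leNgt => fx; congr EFin; apply/eqP; rewrite eq_le fx f0.
Qed.

(* Lebesgue measure on the support is absolutely continuous with respect to mu,
   in the quantitative epsilon-delta form. *)
Lemma density_lower_bound (e : R) : (leb supp < +oo)%E -> 0 < e ->
  exists2 delta : R, 0 < delta & forall U, measurable U -> U `<=` supp ->
    (e%:E <= leb U)%E -> (delta%:E <= mu U)%E.
Proof.
move=> finA e0; have [mf f0 muE] := f_density.
have mA := measurable_preimage_density `]0, +oo[.
have finA' : leb supp \is a fin_num by rewrite ge0_fin_numE.
(* These sets exhaust the support. Once less than e/2 is left out, [U] keeps Lebesgue measure at
   least e/2 inside [B n], where f > 1/(n + 1); the product of the two is [delta]. *)
pose B n := f @^-1` `]n.+1%:R^-1, +oo[.
have mB n : measurable (B n) by exact: measurable_preimage_density.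
have BA n : B n `<=` supp.
  move=> x; rewrite /B/= !in_itv/= !andbT; apply: lt_trans.
  by rewrite invr_gt0.
have AB : supp = \bigcup_n B n.
  apply/seteqP; split=> x; last by move=> [n _ /BA].
  rewrite /= in_itv/= andbT => fx.
  have [n _ /(_ n (leqnn n)) ne] := near_infty_natSinv_lt (PosNum fx).
  by exists n => //; rewrite /B/= in_itv/= andbT.
have cvgB : leb (B n) @[n --> \oo] --> leb supp.
  rewrite AB; apply: nondecreasing_cvg_mu => //.
    by rewrite -AB.
  move=> m n mn; apply/subsetPset => x; rewrite /B/= !in_itv/= !andbT.
  by apply: le_lt_trans; rewrite lef_pV2 ?posrE// ler_nat.
have /cvgB[n _ /(_ n (leqnn n))/= nB] :
    nbhs (leb supp) [set y | (leb supp - (e / 2)%:E < y)%E].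
  apply: open_nbhs_nbhs; split; first exact: open_ereal_gt_ereal.
  by rewrite /= -(fineK finA') -EFinB lte_fin ltrBlDr ltrDl divr_gt0.
have finB : leb (B n) \is a fin_num.
  rewrite ge0_fin_numE//; apply: le_lt_trans finA.
  by apply: le_measure; rewrite ?inE.
exists (n.+1%:R^-1 * (e / 2)); first by rewrite mulr_gt0 ?invr_gt0 ?divr_gt0.
move=> U mU UA eU.
have mUB : measurable (U `&` B n) by exact: measurableI.
have UBe : ((e / 2)%:E <= leb (U `&` B n))%E.
  have UDe : (leb (U `\` B n) <= (e / 2)%:E)%E.
    apply: (@le_trans _ _ (leb (supp `\` B n))).
      by apply: le_measure; rewrite ?inE; [exact: measurableD|exact: measurableD|exact: setSD].
    rewrite measureD//.
    rewrite (setIidr (BA n)); move: nB; rewrite -(fineK finA') -(fineK finB).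
    rewrite -!EFinB lte_fin => nB'.
    rewrite -[X in (X - _)%E]fineK// -[X in (_ - X)%E]fineK// -EFinB lee_fin.
    by lra.
  have UE : leb U = (leb (U `&` B n) + leb (U `\` B n))%E.
    by rewrite addeC -measureDI.
  have finUB : leb (U `&` B n) \is a fin_num.
    rewrite ge0_fin_numE//; apply: le_lt_trans finA.
    apply: le_measure; rewrite ?inE//; last by move=> x [_ /BA].
  have finUD : leb (U `\` B n) \is a fin_num.
    rewrite ge0_fin_numE//; apply: le_lt_trans finA.
    apply: le_measure; rewrite ?inE//; first exact: measurableD.
    by move=> x [/UA].
  move: eU UDe; rewrite UE -(fineK finUB) -(fineK finUD) -EFinD !lee_fin.
  by lra.
apply: (@le_trans _ _ (mu (U `&` B n))); last first.
  by apply: le_measure; rewrite ?inE.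
rewrite muE//; apply: (@le_trans _ _ (\int[leb]_(x in U `&` B n) cst n.+1%:R^-1%:E x)%E).
  rewrite integral_cst// EFinM. apply: lee_pmul => //.
  by rewrite lee_fin ltW// divr_gt0.
apply: ge0_le_integral => //.
- by move=> x _; rewrite lee_fin.
- by apply/measurable_realfun.measurable_EFinP; apply: measurable_funS mf.
- by move=> x [_]; rewrite /B/= in_itv/= andbT lee_fin => /ltW.
Qed.

Context {disp : measure_display} {Omega : measurableType disp}.
Variables (P : probability Omega R) (X : nat -> {RV P >-> 'rV[R]_d}).
Hypothesis X_distr : identically_distributed X mu.
Hypothesis X_indep : mutually_independent X.

Lemma ae_sample_in_support : {ae P, forall w, forall i, supp (X i w)}.
Proof.
apply: ae_foralln => i; exists (X i @^-1` (~` supp)); split => //.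
  rewrite -[X in measurable X]setTI; apply: measurable_funPT => //.
  by apply: measurableC; exact: measurable_preimage_density.
have mC : measurable (~` supp).
  by apply: measurableC; exact: measurable_preimage_density.
by rewrite -density_supportC -(X_distr i mC).
Qed.

Definition missed n U : set Omega := \bigcap_(i in `I_n) (X i @^-1` (~` U)).

Lemma measurable_missed n U : measurable U -> measurable (missed n U).
Proof.
move=> mU; apply: bigcap_measurableType => i _.
rewrite -[X in measurable X]setTI; apply: measurable_funPT => //.
exact: measurableC.
Qed.

(** By independence the probability is (1 - mu U)^n, and 1 - delta <= exp(- delta). *)
Lemma missed_le n U (delta : R) : measurable U -> 0 <= delta ->
  (delta%:E <= mu U)%E -> (P (missed n U) <= (expR (- (delta * n%:R)))%:E)%E.
Proof.
move=> mU delta0 dU; have mC := measurableC mU.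
have -> : missed n U = \bigcap_(i in [set` seq_fset tt (iota 0 n)]) (X i @^-1` (~` U)).
  by congr bigcap; apply/seteqP; split=> i; rewrite /mkset ?seq_fsetE ?mem_iota.
rewrite (X_indep (seq_fset tt (iota 0 n)) (fun=> mC))//.
have finU : mu U \is a fin_num by exact: fin_num_measure.
rewrite (eq_bigr (fun=> (1 - fine (mu U))%:E)) => [|i _]; last first.
  by rewrite -[LHS]/(distribution P (X i) _) X_distr// probability_setC// EFinB fineK.
rewrite prodEFin big_const_seq count_predT iter_mulr_1 size_seq_fset undup_id ?iota_uniq//.
rewrite size_iota lee_fin (mulrC delta) -mulrN expRM_natl.
have : (mu U <= 1)%E by exact: probability_le1.
move: dU; rewrite -(fineK finU) !lee_fin => dU U1.
rewrite lerXn2r ?nnegrE ?expR_ge0 ?subr_ge0//.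
by apply: le_trans (expR_ge1Dx _); rewrite lerD2l lerN2.
Qed.

Lemma sum_geometric_lty (q : R) : 0 <= q -> q < 1 ->
  (\sum_(0 <= n <oo) (q ^+ n)%:E < +oo)%E.
Proof.
move=> q0 q1.
apply: (@le_lt_trans _ _ ((1 - q)^-1)%:E); last exact: ltry.
apply: lime_le; first by apply: is_cvg_nneseries => n _ _; rewrite lee_fin exprn_ge0.
near=> n; rewrite sumEFin lee_fin.
have := geometric_seriesE 1 (negbT (lt_eqF q1)).
move=> /(congr1 (fun u : R ^nat => u n)); rewrite /series/= => E.
rewrite (eq_bigr (fun k => 1 * q ^+ k)) => [|k _]; last by rewrite mul1r.
rewrite E mul1r -[leRHS]mul1r ler_pM2r ?invr_gt0 ?subr_gt0//.
by rewrite lerBlDr lerDl exprn_ge0.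
Unshelve. all: by end_near. Qed.

Variables (I : nat -> finType) (U_ : forall n, I n -> set 'rV[R]_d).
Hypothesis mU_ : forall n i, measurable (U_ (n := n) i).
Hypothesis U_supp : forall n i, U_ (n := n) i `<=` supp.
Hypothesis cardI : forall e : R, 0 < e -> \forall n \near \oo,
  #|I n|%:R <= e * n%:R.

(* There are only exp(o(n)) unions of sets of the n-th family, and each of
   those with Lebesgue measure at least e is missed with probability at most
   exp(- delta n). *)
Lemma ae_missed_small (e : R) : (leb supp < +oo)%E -> 0 < e ->
  {ae P, forall w, \forall n \near \oo,
    (leb (\bigcup_(i in [set i : I n | missed n (U_ i) w]) U_ i) < e%:E)%E}.
Proof.
move=> finA e0; have [delta delta0 hdelta] := density_lower_bound finA e0.
have mUn n (J : set (I n)) : measurable (\bigcup_(i in J) U_ i).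
  by apply: fin_bigcup_measurable => //; exact: finite_finset.
(* The bad event: some subfamily whose union has Lebesgue measure at least [e] is missed
   entirely. *)
pose E n := \big[setU/set0]_(J : {set I n} |
    `[< (e%:E <= leb (\bigcup_(i in [set` J]) U_ i))%E >])
  missed n (\bigcup_(i in [set` J]) U_ i).
have mE n : measurable (E n).
  by apply: bigsetU_measurable => J _; exact: measurable_missed.
(* Half of the exponent pays for the 2^#|I n| <= exp(#|I n|) subfamilies as soon as #|I n| <= (delta
   / 2) n. *)
pose q := expR (- (delta / 2)) : R.
have PE n : #|I n|%:R <= delta / 2 * n%:R -> (P (E n) <= (q ^+ n)%:E)%E.
  move=> In; apply: (le_trans (measure_bigsetU_le _ _ _ _)).
    by move=> J; exact: measurable_missed.
  apply: (@le_trans _ _ (\sum_(J : {set I n}) (expR (- (delta * n%:R)))%:E)%E).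
    rewrite big_mkcond; apply: lee_sum => J _; case: asboolP => [eJ|_].
      apply: missed_le => //; first exact: ltW.
      by apply: hdelta => // x [i _]; exact: U_supp.
    by rewrite lee_fin expR_ge0.
  rewrite sumEFin lee_fin sumr_const.
  have -> : #|{: {set I n}}| = (2 ^ #|I n|)%N.
    by rewrite -[#|I n|]cardsT -card_powerset powersetT cardsT.
  rewrite -[leLHS]mulr_natl natrX.
  apply: (@le_trans _ _ (expR (#|I n|%:R) * expR (- (delta * n%:R)))).
    rewrite ler_pM2r ?expR_gt0// -[in leRHS](mulr1 #|I n|%:R) expRM_natl.
    rewrite lerXn2r ?nnegrE ?expR_ge0//.
    by apply: le_trans (expR_ge1Dx 1).
  rewrite -expRD /q -expRM_natl ler_expR.
  by lra.
(* The cardinality bound holds only eventually; emptying the other terms makes the whole series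
   converge and leaves the terms of large index unchanged. *)
pose E' n := if #|I n|%:R <= delta / 2 * n%:R then E n else set0.
have E'0 : P (lim_sup_set E') = 0%E.
  apply: lim_sup_set_cvg0.
    by move=> n; rewrite /E'; case: ifP.
  apply: le_lt_trans (@sum_geometric_lty q _ _).
  - apply: lee_nneseries => // n _; rewrite /E'; case: ifP => [/PE//|_].
    by rewrite measure0 lee_fin exprn_ge0// expR_ge0.
  - exact: expR_ge0.
  - by rewrite -expR0 ltr_expR; lra.
exists (lim_sup_set E'); split => //.
  apply: bigcap_measurableType => n _.
  by apply: bigcup_measurable => k _; rewrite /E'; case: ifP.
move=> w /= wE n _; apply: contrapT => wn; apply: wE.
have [N _ NI] := cardI (divr_gt0 delta0 (ltr0n R 2)).
exists (maxn n N) => // k /=; rewrite geq_max => /andP[nk Nk].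
rewrite ltNge; apply/negP => ek; apply: wn; exists k => //.
rewrite /E' ifT; last exact: NI.
(* The family actually missed at [w] is one of the subfamilies in the union defining [E k]. *)
pose J := [set i : I k | `[< missed k (U_ i) w >]]%SET.
have JE : [set` J] = [set i : I k | missed k (U_ i) w].
  by apply/seteqP; split=> i /=; rewrite inE => /asboolP.
rewrite /E (bigD1 J)/=; last by apply/asboolP; rewrite JE.
by left; move=> j jk /= [i]; rewrite JE => /(_ j jk).
Qed.

End missed_sets.

(** * Upper and lower bounds for the rescaled functional of the sample *)

Section law_of_large_numbers.
Context {R : realType} {d : nat}.
Implicit Types (x y : 'rV[R]_d) (S Y Z : {fset 'rV[R]_d}).
Local Notation leb := (lebesgue_rV R d).

(** In each coordinate a target stays within r (s/2 + 1/4) of the centre, less than half the side of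
    the cell. *)
Lemma target_sub_cell (s r eta : R) S k x : 0 < s -> 0 < r ->
    0 < eta <= 4^-1 -> [set` S] `<=` cube s -> x \in S ->
  target ((s + 2) * r) r eta k x `<=` cell ((s + 2) * r) k.
Proof.
move=> s0 r0 /andP[eta0 eta4] Ss xS y.
move=> /ball_rVP - /(_ (mulr_gt0 r0 eta0)) xy; apply/cell_cube => i.
have := Ss _ xS i; have := xy i; rewrite !in_itv/= !mxE.
move: (_ * (_ + _)) (y ord0 i) (x ord0 i) => z t u.
rewrite ltr_norml => /andP[h1 h2] /andP[h3 h4].
by apply/andP; split; nra.
Qed.

(** With a single target per cell, disjointness is inherited from the cells. *)
Lemma lebesgue_targets (s r eta : R) S (K : {fset 'rV[int]_d})
    (x_ : 'rV[int]_d -> 'rV[R]_d) : 0 < s -> 0 < r ->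
    0 < eta <= 4^-1 -> [set` S] `<=` cube s ->
    (forall k, k \in K -> x_ k \in S) ->
  leb (\bigcup_(k in [set` K]) target ((s + 2) * r) r eta k (x_ k)) =
    (#|` K|%:R * (2 * (r * eta)) ^+ d)%:E.
Proof.
move=> s0 r0 eta04 Ss KS; have /andP[eta0 _] := eta04.
rewrite measure_fin_bigcup//=.
- rewrite (eq_fsbigr (fun=> ((2 * (r * eta)) ^+ d)%:E)) => [|k _]; last first.
    by rewrite lebesgue_rV_ball// mulr_gt0.
  rewrite fsbig_finite//= set_fsetK sumEFin big_const_seq count_predT iter_addr_0.
  by congr EFin; rewrite [RHS]mulr_natl.
- move=> k l /KS kS /KS lS [y [yk yl]].
  apply: (@trivIset_cell _ _ ((s + 2) * r) _ setT) => //.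
    by rewrite mulr_gt0// addr_gt0.
  exists y; split; first exact: (target_sub_cell s0 r0 eta04 Ss kS).
  exact: (target_sub_cell s0 r0 eta04 Ss lS).
- by move=> k _; apply: open_measurable_rV; exact: ball_open.
Qed.

Variable zeta : {fset 'rV[R]_d} -> R.

Hypothesis zeta_ge0 : forall S, 0 <= zeta S.
Hypothesis zeta_fset0 : zeta fset0 = 0.
Hypothesis zeta_bnd : bounded_on_half_ball zeta.
Hypothesis zeta_incr : increasing_functional zeta.
Hypothesis zeta_inv : graph_invariant zeta.
Hypothesis zeta_superadd : superadditive_up_to_boundary zeta.

Variable c : R.
Hypothesis c_ge0 : 0 <= c.
Hypothesis zeta_subadd : forall Y Z, [disjoint Y & Z]%fset ->
  zeta (Y `|` Z)%fset <= zeta Y + zeta Z + c.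

Variable A : set 'rV[R]_d.
Hypothesis bA : bounded_set A.
Hypothesis mA : measurable A.
Hypothesis bndA : leb (boundary A) = 0%E.

Variable r : nat -> R.
Hypothesis r_gt0 : forall n, (0 < n)%N -> 0 < r n.
Hypothesis r_cvg0 : r n @[n --> \oo] --> 0.

Let a := fine (leb A).
Let L := scaling_rate zeta c.

Let a_ge0 : 0 <= a. Proof. by rewrite fine_ge0. Qed.

Let L_ge0 : 0 <= L. Proof. exact: (scaling_rate_ge0 zeta_fset0 zeta_inv zeta_bnd c_ge0 zeta_subadd). Qed.

(** The threshold on [n] is uniform in [S], so the bound can be applied to a random sample. *)
Lemma rescaled_upper (e : R) : 0 < e -> \forall n \near \oo,
  forall S, [set` S] `<=` A -> r n ^+ d * rescaled zeta (r n) S <= L * a + e.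
Proof.
move=> e0.
(* Chosen so that (a + e1) (L + e1) <= L a + e1 (a + L + 1) <= L a + e. *)
pose e1 := Num.min 1 (e / (a + L + 1)).
have aL0 : 0 < a + L + 1 by rewrite ltr_wpDl// addr_ge0.
have e10 : 0 < e1 by rewrite lt_min ltr01 divr_gt0.
have e11 : e1 <= 1 by rewrite ge_min lexx.
have e1e : e1 * (a + L + 1) <= e by rewrite -ler_pdivlMr// ge_min lexx orbT.
have [s s0 sL] := scaling_rate_adherent zeta_fset0 zeta_inv zeta_bnd
  c_ge0 zeta_subadd e10.
have [rho0 rho00 hrho] := outer_cells_le bA mA bndA e10.
have sup0 : 0 <= cube_sup zeta s + c.
  by rewrite addr_ge0//; exact: (cube_sup_ge0 zeta_fset0 zeta_inv zeta_bnd zeta_subadd).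
near=> n => S SA.
have n0 : (0 < n)%N by near: n; exact: nbhs_infty_gt.
have rn0 := r_gt0 n0.
have srn : 0 < s * r n by rewrite mulr_gt0.
have rnrho : s * r n <= rho0.
  rewrite -ler_pdivlMl//; near: n.
  by apply: (cvgr_le 0) => //; rewrite mulr_gt0 ?invr_gt0.
have := hrho _ srn rnrho.
set N := #|` _|%:R => Na.
have zN : rescaled zeta (r n) S <= N * (cube_sup zeta s + c).
  apply: (cover_bound zeta_fset0 (rho := s)) => //.
    by apply: cell_bound => // T Ts; exact: (cube_sup_ge zeta_fset0 zeta_inv zeta_bnd zeta_subadd).
  move=> _ /imfsetP[x xS ->]; rewrite in_fset_set; last exact: finite_cell_index.
  rewrite inE; exists x; first exact: SA.
  (* Dividing by [r n] turns cells of side [s * r n] into cells of side [s] with the same index. *)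
  by apply/rowP => i; rewrite !mxE; congr Num.floor; rewrite invfM; ring.
apply: (@le_trans _ _ (r n ^+ d * (N * (cube_sup zeta s + c)))).
  by rewrite ler_pM2l// exprn_gt0.
have -> : r n ^+ d * (N * (cube_sup zeta s + c)) =
    (N * (s * r n) ^+ d) * ((cube_sup zeta s + c) / s ^+ d).
  by rewrite exprMn; field; rewrite gt_eqF// exprn_gt0.
apply: (@le_trans _ _ ((a + e1) * (L + e1))).
  apply: ler_pM => //; last exact: ltW.
  - by rewrite mulr_ge0// exprn_ge0// ltW.
  - by rewrite divr_ge0// exprn_ge0// ltW.
by nra.
Unshelve. all: by end_near. Qed.

Variables (mu : probability 'rV[R]_d R) (f : 'rV[R]_d -> R).
Hypothesis f_density : is_density mu f.
Hypothesis AE : A = f @^-1` `]0, +oo[.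
Context {disp : measure_display} {Omega : measurableType disp}.
Variables (P : probability Omega R) (X : nat -> {RV P >-> 'rV[R]_d}).
Hypothesis X_distr : identically_distributed X mu.
Hypothesis X_indep : mutually_independent X.
Hypothesis nr_cvgy : n%:R * r n ^+ d @[n --> \oo] --> +oo.
Hypothesis d_gt0 : (0 < d)%N.

(** Three losses of at most e/3 each: [e1] for the configuration not being optimal, [e2] for cells
    with a missed target, [e3] for the part of [A] outside the inner cells. *)
Lemma ae_rescaled_lower (e : R) : 0 < e ->
  {ae P, forall w, \forall n \near \oo,
    L * a - e <= r n ^+ d * rescaled zeta (r n) (sample (fun i => X i w) n)}.
Proof.
move=> e0.
have e10 : 0 < e / (3 * (a + 1)) by rewrite divr_gt0// mulr_gt0// ltr_wpDl.
set e1 := e / _ in e10.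
have [s [S [s0 Ss LS]]] := near_optimal_configuration zeta_fset0
  zeta_inv zeta_bnd c_ge0 zeta_subadd d_gt0 e10.
rewrite -/L in LS.
have [S' [eta [eta04 S's rob]]] := robust_configuration zeta_inv s0 Ss.
have /andP[eta0 eta4] := eta04.
have s2 : 0 < s + 2 by rewrite addr_gt0.
set b := zeta S / _ in LS.
have b0 : 0 <= b by rewrite divr_ge0// exprn_ge0// ltW.
have e30 : 0 < e / (3 * (b + 1)) by rewrite divr_gt0// mulr_gt0// ltr_wpDl.
set e3 := e / _ in e30.
(* A target has volume (2 eta r)^d, so missed targets of total volume at most [e2] spoil at most e /
   (3 (zeta S + 1) r^d) cells. *)
have e20 : 0 < e * (2 * eta) ^+ d / (3 * (zeta S + 1)).
  by rewrite divr_gt0 ?mulr_gt0 ?exprn_gt0 ?mulr_gt0// ltr_wpDl.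
set e2 := _ / _ in e20.
pose rho n := (s + 2) * r n.
(* The sign of [r 0] is unknown; an empty family keeps the inclusion of the targets in the support
   valid for every [n]. *)
pose K n : {fset 'rV[int]_d} := if 0 < r n then inner_cells (rho n) A else fset0.
pose I n : finType := (K n * S')%type.
pose U n (i : I n) := target (rho n) (r n) eta (val i.1) (val i.2).
have KA n (k : 'rV[int]_d) : k \in K n -> 0 < r n /\ cell (rho n) k `<=` A.
  rewrite /K; case: ifPn => [rn|_]; last by rewrite inE.
  have rho0 : 0 < rho n by rewrite mulr_gt0.
  by rewrite in_fset_set ?inE//; exact: finite_inner_cells.
have mU n (i : I n) : measurable (U n i).
  by apply: open_measurable_rV; exact: ball_open.
have UA n (i : I n) : U n i `<=` f @^-1` `]0, +oo[.
  have [rn kA] := KA n _ (valP i.1).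
  rewrite -AE; apply: subset_trans kA.
  by apply: target_sub_cell S's (valP i.2).
have finA : (leb A < +oo)%E by exact: lebesgue_bounded.
(* There are at most a / ((s + 2) r)^d inner cells, hence o(n) targets because n r^d tends to
   infinity. *)
have cardI (e' : R) : 0 < e' -> \forall n \near \oo, #|I n|%:R <= e' * n%:R.
  move=> e'0; near=> n.
  have n0 : (0 < n)%N by near: n; exact: nbhs_infty_gt.
  have rn0 := r_gt0 n0; have rho0 : 0 < rho n by rewrite mulr_gt0.
  have rd0 : 0 < r n ^+ d by rewrite exprn_gt0.
  have : a * #|` S'|%:R / (s + 2) ^+ d / e' <= n%:R * r n ^+ d.
    by near: n; move/cvgryPge : nr_cvgy; exact.
  rewrite card_prod -!cardfE natrM /K rn0 ler_pdivrMr// ler_pdivrMr ?exprn_gt0//.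
  have := inner_cells_le rho0 bA mA; rewrite -/a /rho exprMn.
  set k := #|` _|%:R; set m := #|` _|%:R => h1 h2.
  rewrite -(ler_pM2r (mulr_gt0 (exprn_gt0 d s2) rd0)).
  apply: (@le_trans _ _ (a * m)).
    by rewrite mulrAC ler_wpM2r.
  by apply: (le_trans h2); rewrite le_eqVlt; apply/orP; left; apply/eqP; ring.
have finA' : (leb (f @^-1` `]0%R, +oo[) < +oo)%E by rewrite -AE.
have [rho1 rho10 hrho] := inner_cells_ge bA mA bndA e30.
have := ae_missed_small f_density X_distr X_indep mU UA cardI finA' e20.
apply: filterS => w hw; near=> n.
have n0 : (0 < n)%N by near: n; exact: nbhs_infty_gt.
have rn0 := r_gt0 n0; have rho0 : 0 < rho n by rewrite mulr_gt0.
have rd0 : 0 < r n ^+ d by rewrite exprn_gt0.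
have hwn : (leb (\bigcup_(i in [set i : I n | missed X n (U n i) w]) U n i)
    < e2%:E)%E by near: n.
have Ka : a - e3 <= #|` K n|%:R * rho n ^+ d.
  rewrite /K rn0; apply: hrho => //.
  rewrite /rho -ler_pdivlMl//; near: n.
  by apply: (cvgr_le 0) => //; rewrite mulr_gt0 ?invr_gt0.
set Y := sample _ n.
pose good k := `[< forall x, x \in S' ->
  exists2 y, y \in Y & target (rho n) (r n) eta k x y >].
pose G := [fset k in K n | good k]%fset.
pose B := [fset k in K n | ~~ good k]%fset.
have KGB : (#|` K n| = #|` G| + #|` B|)%N.
  rewrite -cardfsUI (_ : (G `&` B)%fset = fset0) ?cardfs0 ?addn0; last first.
    by apply/fsetP => k; rewrite !inE/=; case: (good k); rewrite ?andbF.
  congr (size (enum_fset _)); apply/fsetP => k; rewrite !inE/=.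
  by case: (good k); rewrite ?andbF ?andbT ?orbF.
have Gz : #|` G|%:R * zeta S <= rescaled zeta (r n) Y.
  apply: (rescaled_ge_good_cells zeta_inv zeta_incr zeta_superadd zeta_fset0
    s0 rn0 eta04 S's rob) => k x.
  by rewrite !inE/= => /andP[_ /asboolP]; exact.
(* One missed target is selected in each bad cell, so that their total volume counts the bad
   cells. *)
have [x_ hx_] : exists x_ : 'rV[int]_d -> 'rV[R]_d, forall k, k \in B ->
    x_ k \in S' /\ forall y, y \in Y -> ~ target (rho n) (r n) eta k (x_ k) y.
  have /choice[x_ hx_] : forall k, exists x, k \in B ->
      x \in S' /\ forall y, y \in Y -> ~ target (rho n) (r n) eta k x y.
    move=> k; have [kB|_] := boolP (k \in B); last by exists 0.
    move: kB; rewrite !inE/= => /andP[_ /asboolPn/existsNP[x]].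
    move=> /not_implyP[xS hx]; exists x => _; split => // y yY xy.
    by apply: hx; exists y.
  by exists x_.
have Be2 : #|` B|%:R * (2 * (r n * eta)) ^+ d <= e2.
  rewrite -lee_fin -(lebesgue_targets s0 rn0 eta04 S's (x_ := x_)); last first.
    by move=> k /hx_[].
  apply: le_trans (ltW hwn); apply: le_measure; rewrite ?inE.
  - apply: fin_bigcup_measurable => // k _.
    by apply: open_measurable_rV; exact: ball_open.
  - apply: fin_bigcup_measurable => [|i _]; last exact: mU.
    exact: finite_finset.
  - move=> y [k /= kB ky]; have [xS hx] := hx_ _ kB.
    have kK : k \in K n by move: kB; rewrite !inE => /andP[].
    exists ([` kK]%fset, [` xS]%fset) => //= i /= ni.
    by apply: hx; apply/imfsetP; exists i => //=; rewrite mem_iota.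
have z0 := zeta_ge0 S.
have e1E : 3 * e1 * (a + 1) = e.
  by rewrite /e1; field; rewrite gt_eqF// ltr_wpDl.
have e2E : 3 * e2 * (zeta S + 1) = e * (2 * eta) ^+ d.
  by rewrite /e2; field; rewrite gt_eqF// ltr_wpDl.
have e3E : 3 * e3 * (b + 1) = e.
  by rewrite /e3; field; rewrite gt_eqF// ltr_wpDl.
have D0 : 0 < (2 * eta) ^+ d by rewrite exprn_gt0// mulr_gt0.
have zb : zeta S = b * (s + 2) ^+ d by rewrite /b divfK// gt_eqF// exprn_gt0.
apply: (@le_trans _ _ (r n ^+ d * (#|` G|%:R * zeta S))); last by rewrite ler_pM2l.
have GE : #|` G|%:R = #|` K n|%:R - #|` B|%:R :> R.
  by rewrite KGB natrD addrK.
have h1 : b * (a - e3) <= #|` K n|%:R * r n ^+ d * zeta S.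
  rewrite zb (_ : _ * (b * _) = b * (#|` K n|%:R * rho n ^+ d)).
    by rewrite ler_wpM2l.
  by rewrite /rho exprMn; ring.
have h2 : #|` B|%:R * r n ^+ d * zeta S <= e / 3.
  have : #|` B|%:R * r n ^+ d <= e / (3 * (zeta S + 1)).
    rewrite -(ler_pM2r D0).
    by move: Be2; rewrite /e2 (_ : 2 * (r n * eta) = r n * (2 * eta));
      [rewrite exprMn mulrA mulrAC [in leRHS]mulrAC|ring].
  rewrite ler_pdivlMr; last by rewrite mulr_gt0// ltr_wpDl.
  have : 0 <= #|` B|%:R * r n ^+ d by rewrite mulr_ge0// ltW.
  by move: (#|` B|%:R * r n ^+ d) => t; nra.
have -> : r n ^+ d * (#|` G|%:R * zeta S) =
    #|` K n|%:R * r n ^+ d * zeta S - #|` B|%:R * r n ^+ d * zeta S.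
  by rewrite GE; ring.
have La : L * a <= (b + e1) * a by rewrite ler_wpM2r// -lerBlDr.
move: h1 h2; move: (_ * zeta S) (_ * zeta S) => t u h1 h2.
by lra.
Unshelve. all: by end_near. Qed.

End law_of_large_numbers.

Theorem theorem2p7 (R : realType) (d : nat) (d_gt0 : (0 < d)%N)
    (zeta : {fset 'rV[R]_d} -> R)
    (zeta_ge0 : forall S : {fset 'rV[R]_d}, 0 <= zeta S)
    (zeta_fset0 : zeta fset0 = 0)
    (P3 : almost_subadditive zeta)
    (P4 : superadditive_up_to_boundary zeta)
    (P5' : bounded_on_half_ball zeta)
    (P6 : increasing_functional zeta)
    (P8 : graph_invariant zeta)
    (mu : probability 'rV[R]_d R)
    (mu_ac : mu `<< lebesgue_rV R d)
    (f : 'rV[R]_d -> R)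
    (f_density : is_density mu f)
    (f_supp : riemann_measurable (f @^-1` `]0, +oo[))
    (disp : measure_display) (Omega : measurableType disp)
    (P : probability Omega R)
    (X : nat -> {RV P >-> 'rV[R]_d})
    (X_distr : identically_distributed X mu)
    (X_indep : mutually_independent X)
    (r : nat -> R)
    (r_gt0 : forall n, (0 < n)%N -> 0 < r n)
    (r_cvg0 : r n @[n --> \oo] --> 0)
    (nr_cvgy : n%:R * r n ^+ d @[n --> \oo] --> +oo) :
  {ae P, forall w,
    (r n ^+ d * rescaled zeta (r n) (sample (fun i => X i w) n))%:E
      @[n --> \oo] -->
    (zeta_bar zeta * lebesgue_rV R d (f @^-1` `]0%R, +oo[))%E}.
Proof.
have [c c_ge0 zeta_subadd] := P3; have [bA A0] := f_supp.
set A := f @^-1` _ in bA A0 *.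
have mA : measurable A by exact: measurable_preimage_density f_density _.
have finA : lebesgue_rV R d A \is a fin_num.
  by rewrite ge0_fin_numE//; exact: lebesgue_bounded.
rewrite (zeta_barE zeta_fset0 P8 P5' c_ge0 zeta_subadd d_gt0) -(fineK finA).
rewrite -EFinM.
(* Countably many error levels 1/(j + 1) give a single null set valid for all of them. *)
have low : {ae P, forall w, forall j : nat, \forall n \near \oo,
    scaling_rate zeta c * fine (lebesgue_rV R d A) - j.+1%:R^-1 <=
    r n ^+ d * rescaled zeta (r n) (sample (fun i => X i w) n)}.
  apply: ae_foralln => j.
  by apply: (ae_rescaled_lower zeta_ge0 zeta_fset0 P5' P6 P8 P4 c_ge0
    zeta_subadd bA mA A0 r_gt0 r_cvg0 f_density erefl X_distr X_indep
    nr_cvgy d_gt0); rewrite invr_gt0.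
(* For the upper bound, the only random input is that every sample point lies in the support. *)
apply: filterS2 low (ae_sample_in_support f_density X_distr) => w low supp.
apply: cvg_EFin; first exact: nearW.
apply/cvgrPdist_le => e e0.
have upp := rescaled_upper zeta_fset0 P5' P8 c_ge0 zeta_subadd bA mA A0
  r_gt0 r_cvg0 e0.
have [j _ /(_ j (leqnn j)) je] := near_infty_natSinv_lt (PosNum e0).
near=> n; rewrite distrC ler_distl; apply/andP; split.
  apply: (@le_trans _ _ (scaling_rate zeta c * fine (lebesgue_rV R d A) - j.+1%:R^-1)).
    by rewrite lerD2l lerN2 ltW.
  by near: n; exact: low.
have uppn : forall S : {fset 'rV[R]_d}, [set` S] `<=` A ->
    r n ^+ d * rescaled zeta (r n) S <=
      scaling_rate zeta c * fine (lebesgue_rV R d A) + e by near: n; exact: upp.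
by apply: uppn => _ /= /imfsetP[i _ ->]; exact: supp.
Unshelve. all: by end_near. Qed.
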